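(* Let $p$ be an odd prime, let $\mathcal{N}$ be the Nottingham group over $\mathbb{F}_p$, and let $n_0=2$ if $p>3$ and $n_0=5$ if $p=3$. Then for every $n\ge n_0$ there exists a quotient of $\mathcal{N}$ of order $p^n$ which is a Beauville group.
   Context: The Nottingham group $\mathcal{N}$ over $\mathbb{F}_p$ is the group, under composition, of normalised automorphisms of the ring $\mathbb{F}_p[[t]]$; each $f\in\mathcal{N}$ is completely determined by the image $f(t)$, which is of the form $f(t)=t+\sum_{i\ge 2}a_it^i$ with $a_i\in\mathbb{F}_p$ (all such series occur). For elements $x,y$ of a finite group $G$ let $\Sigma(x,y)=\bigcup_{g\in G}\big(\langle x\rangle^g\cup\langle y\rangle^g\cup\langle xy\rangle^g\big)$. A Beauville structure for $G$ is a pair of generating sets $\{x_1,y_1\}$, $\{x_2,y_2\}$ of $G$ such that $\Sigma(x_1,y_1)\cap\Sigma(x_2,y_2)=1$. $G$ is a Beauville group if it has a Beauville structure. *)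

(* Defs.v *)
From HB Require Import structures.
From mathcomp Require Import all_boot all_order all_algebra all_fingroup.
From mathcomp Require Import boolp.

Set Implicit Arguments.
Unset Strict Implicit.
Unset Printing Implicit Defensive.

Import GRing.Theory.

Section FormalPowerSeries.
Local Open Scope ring_scope.

Record fps (R : Type) := Fps { fps_coef :> nat -> R }.

HB.instance Definition _ (R : Type) := [isNew for @fps_coef R].
HB.instance Definition _ (R : choiceType) := [Choice of fps R by <:].

Variable R : comNzRingType.
Implicit Types s u v : fps R.

Lemma fpsP s u : s =1 u -> s = u.
Proof. by move=> su; apply/val_inj/funext. Qed.

Definition fps0 : fps R := Fps (fun=> 0).
Definition fps1 : fps R := Fps (fun n => (n == 0%N)%:R).
Definition fps_opp s : fps R := Fps (fun n => - s n).
Definition fps_add s u : fps R := Fps (fun n => s n + u n).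
Definition fps_mul s u : fps R :=
  Fps (fun n => \sum_(i < n.+1) s i * u (n - i)%N).

Fact fps_addA : associative fps_add.
Proof. by move=> s u v; apply/fpsP => n /=; rewrite addrA. Qed.
Fact fps_addC : commutative fps_add.
Proof. by move=> s u; apply/fpsP => n /=; rewrite addrC. Qed.
Fact fps_add0 : left_id fps0 fps_add.
Proof. by move=> s; apply/fpsP => n /=; rewrite add0r. Qed.
Fact fps_addN : left_inverse fps0 fps_opp fps_add.
Proof. by move=> s; apply/fpsP => n /=; rewrite addNr. Qed.

HB.instance Definition _ :=
  GRing.isZmodule.Build (fps R) fps_addA fps_addC fps_add0 fps_addN.

(* The ring laws are inherited from {poly R}: the n-th coefficient of a product
   only depends on the truncations of the factors. *)
Let trunc m s : {poly R} := \poly_(i < m) s i.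

Let coef_trunc m s i : (i < m)%N -> (trunc m s)`_i = s i.
Proof. by move=> im; rewrite coef_poly im. Qed.

Let fps_mulE m s u n : (n < m)%N -> fps_mul s u n = (trunc m s * trunc m u)`_n.
Proof.
move=> nm; rewrite coefM /=; apply: eq_bigr => i _.
by rewrite !coef_trunc // (leq_ltn_trans _ nm) ?leq_subr // -ltnS.
Qed.

Fact fps_mulC : commutative fps_mul.
Proof.
by move=> s u; apply/fpsP => n; rewrite !(fps_mulE _ _ (ltnSn n)) mulrC.
Qed.

Fact fps_mulA : associative fps_mul.
Proof.
move=> s u v; apply/fpsP => n; rewrite !(fps_mulE _ _ (ltnSn n)).
transitivity ((trunc n.+1 s * (trunc n.+1 u * trunc n.+1 v))`_n).
  rewrite coefM [RHS]coefM; apply: eq_bigr => i _; congr (_ * _).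
  have nin : (n - i < n.+1)%N by rewrite ltnS leq_subr.
  by rewrite coef_trunc // (fps_mulE _ _ nin).
rewrite mulrA coefM [RHS]coefM; apply: eq_bigr => i _; congr (_ * _).
by rewrite coef_trunc // (fps_mulE _ _ (ltn_ord i)).
Qed.

Fact fps_mul1 : left_id fps1 fps_mul.
Proof.
move=> s; apply/fpsP => n /=.
rewrite big_ord_recl /= mul1r subn0 big1 ?addr0 // => i _.
by rewrite mul0r.
Qed.

Fact fps_mulDl : left_distributive fps_mul fps_add.
Proof.
move=> s u v; apply/fpsP => n /=; rewrite -big_split /=.
by apply: eq_bigr => i _; rewrite mulrDl.
Qed.

Fact fps1_neq0 : fps1 != fps0.
Proof.
by apply/eqP => /(congr1 (fun s : fps R => s 0%N)) /= /eqP; rewrite oner_eq0.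
Qed.

HB.instance Definition _ := GRing.Zmodule_isComNzRing.Build (fps R)
  fps_mulA fps_mulC fps_mul1 fps_mulDl fps1_neq0.

Definition fpsX : fps R := Fps (fun n => (n == 1%N)%:R).

Lemma fps_coefM s u n : (s * u) n = \sum_(i < n.+1) s i * u (n - i)%N.
Proof. by []. Qed.
Lemma fps_coefD s u n : (s + u) n = s n + u n.
Proof. by []. Qed.

Lemma fps_coefM0 s u : (s * u) 0%N = s 0%N * u 0%N.
Proof. by rewrite fps_coefM big_ord1. Qed.
Lemma fps_coefM1 s u : (s * u) 1%N = s 0%N * u 1%N + s 1%N * u 0%N.
Proof. by rewrite fps_coefM big_ord_recl big_ord1. Qed.

Lemma fps_coef_nat n : (n%:R : fps R) 0%N = n%:R.
Proof. by elim: n => // n IHn; rewrite -!natr1 fps_coefD IHn. Qed.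

Lemma fps_split s : s 0%N = 0 -> s = fpsX * Fps (fun n => s n.+1).
Proof.
move=> s0; apply/fpsP => -[|n]; first by rewrite fps_coefM0 /= mul0r.
rewrite fps_coefM big_ord_recl mul0r add0r big_ord_recl /= mul1r big1.
  by rewrite addr0 /bump /= subn1.
by move=> i _; rewrite mul0r.
Qed.

End FormalPowerSeries.

Arguments fpsX {R}.

Section Nottingham.
Local Open Scope ring_scope.
Variable p : nat.
Local Notation P := (fps 'F_p).

(* Normalised means f(t) = t + O(t^2).  For p not prime, 'F_p is the field with
   pdiv p elements. *)
Record normalised_automorphism (f : P -> P) : Prop := NormalisedAutomorphism {
  naut_zmod : zmod_morphism f;
  naut_monoid : GRing.monoid_morphism f;
  naut_bij : bijective f;
  naut_coef0 : f fpsX 0%N = 0;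
  naut_coef1 : f fpsX 1%N = 1
}.

Record nottingham := Nottingham {
  naut :> P -> P;
  _ : `[< normalised_automorphism naut >]
}.

HB.instance Definition _ := [isSub for naut].
HB.instance Definition _ := [Choice of nottingham by <:].

Lemma nottinghamP (f : nottingham) : normalised_automorphism f.
Proof. exact/asboolP/(valP f). Qed.

HB.instance Definition _ (f : nottingham) :=
  GRing.isZmodMorphism.Build P P f (naut_zmod (nottinghamP f)).
HB.instance Definition _ (f : nottingham) :=
  GRing.isMonoidMorphism.Build P P f (naut_monoid (nottinghamP f)).

Lemma nott_coef0 (f : nottingham) (s : P) : f s 0%N = s 0%N.
Proof.
have [_ _ _ f0 _] := nottinghamP f.
have cE : s 0%N = (nat_of_ord (s 0%N))%:R by rewrite natr_Zp.
set c := nat_of_ord _ in cE; set u := s - c%:R.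
have u0 : u 0%N = 0 by rewrite fps_coefD /= fps_coef_nat cE subrr.
have fu0 : f u 0%N = 0.
  by rewrite (fps_split u0) rmorphM fps_coefM0 f0 mul0r.
rewrite -(subrK (c%:R) s) rmorphD rmorph_nat !fps_coefD fu0.
by rewrite -[RHS]/(u 0%N + _) u0.
Qed.

Fact nott_one_subproof : `[< normalised_automorphism (id : P -> P) >].
Proof. by apply/asboolP; split=> //; exists id. Qed.

Fact nott_mul_subproof (f g : nottingham) :
  `[< normalised_automorphism (f \o g) >].
Proof.
have [_ _ fbij f0 f1] := nottinghamP f; have [_ _ gbij g0 g1] := nottinghamP g.
apply/asboolP; split.
- by move=> s u; rewrite /= !rmorphB.
- by split=> [|s u]; rewrite /= ?rmorph1 ?rmorphM.
- exact: bij_comp.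
- by rewrite /= nott_coef0.
- rewrite /= (fps_split g0) rmorphM fps_coefM1 f0 f1 mul0r add0r mul1r.
  by rewrite nott_coef0.
Qed.

Fact nott_inverse_exists (f : nottingham) :
  exists g : P -> P, cancel f g /\ cancel g f.
Proof. by have [g fK gK] := naut_bij (nottinghamP f); exists g. Qed.

Definition nott_inv_fun (f : nottingham) : P -> P :=
  sval (cid (nott_inverse_exists f)).

Fact nott_invK (f : nottingham) : cancel f (nott_inv_fun f).
Proof. by case: (svalP (cid (nott_inverse_exists f))). Qed.
Fact nott_funK (f : nottingham) : cancel (nott_inv_fun f) f.
Proof. by case: (svalP (cid (nott_inverse_exists f))). Qed.

Fact nott_inv_subproof (f : nottingham) :
  `[< normalised_automorphism (nott_inv_fun f) >].
Proof.
have [_ _ _ f0 f1] := nottinghamP f.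
have [K FK] := (@nott_invK f, @nott_funK f).
set g := nott_inv_fun f in K FK *; have finj := can_inj K.
have g0 : g fpsX 0%N = 0 by rewrite -(nott_coef0 f) FK.
apply/asboolP; split=> //.
- by move=> s u; apply: finj; rewrite rmorphB /= !FK.
- by split=> [|s u]; apply: finj; rewrite FK ?rmorph1 // rmorphM /= !FK.
- by exists f.
have := congr1 (fun s : P => s 1%N) (FK fpsX).
rewrite {1}(fps_split g0) rmorphM fps_coefM1 f0 f1 mul0r add0r mul1r.
by rewrite nott_coef0.
Qed.

Definition nott_one := Nottingham nott_one_subproof.
Definition nott_mul f g := Nottingham (nott_mul_subproof f g).
Definition nott_inv f := Nottingham (nott_inv_subproof f).

Fact nott_mulA : associative nott_mul.
Proof. by move=> f g h; apply: val_inj. Qed.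
Fact nott_mul1 : left_id nott_one nott_mul.
Proof. by move=> f; apply: val_inj. Qed.
Fact nott_mulr1 : right_id nott_one nott_mul.
Proof. by move=> f; apply: val_inj. Qed.
Fact nott_mulV : left_inverse nott_one nott_inv nott_mul.
Proof. by move=> f; apply/val_inj/funext => s; apply: nott_invK. Qed.
Fact nott_mulrV : right_inverse nott_one nott_inv nott_mul.
Proof. by move=> f; apply/val_inj/funext => s; apply: nott_funK. Qed.

HB.instance Definition _ := isGroup.Build nottingham
  nott_mulA nott_mul1 nott_mulr1 nott_mulV nott_mulrV.

End Nottingham.

(* By the first isomorphism theorem, gT ranges over the groups isomorphic to
   some N / W with W a normal subgroup of finite index; cf. \homg for finite
   groups. *)
Definition is_finite_quotient (gT : finGroupType) (N : groupType) : Prop :=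
  exists phi : {multiplicative N -> gT}, forall y : gT, exists x : N, phi x = y.

Section Beauville.
Local Open Scope group_scope.
Variable gT : finGroupType.
Implicit Types (G : {group gT}) (x y : gT).

Definition beauville_Sigma G x y : {set gT} :=
  \bigcup_(g in G) (<[x]> :^ g :|: <[y]> :^ g :|: <[x * y]> :^ g).

Definition beauville_structure G x1 y1 x2 y2 : Prop :=
  [/\ <<[set x1; y1]>> = G, <<[set x2; y2]>> = G
    & beauville_Sigma G x1 y1 :&: beauville_Sigma G x2 y2 = 1].

Definition beauville_group G : Prop :=
  exists x1 y1 x2 y2, beauville_structure G x1 y1 x2 y2.

End Beauville.

(* Main.v *)
Require Import Defs.
From HB Require Import structures.
From mathcomp Require Import all_boot all_order all_algebra all_fingroup.
From mathcomp Require Import cyclic boolp.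
From mathcomp Require Import zify ring.

Set Implicit Arguments.
Unset Strict Implicit.
Unset Printing Implicit Defensive.

Import GRing.Theory.

(** Write [X] for the variable. An automorphism [f] has depth [k] if
    [f X = X + u * X ^ (k+1) + v * X ^ (k+2) + ...] with [u] nonzero. The first
    two coefficients of [f X - X], corrected to [(fslope f, fcurv f)], identify
    the quotient by depth 3 with the plane [F_p ^ 2], and a pair of elements
    generates every finite truncation as soon as its images span the plane
    ([generated_of_fdet]).

    The heart of the proof is that the lines of this plane can be read off
    arbitrarily deep in the group. If [h], of depth [d > 1], commutes with [f],
    then comparing the coefficients of [X ^ (d+2)] and [X ^ (d+3)] in
    [f (h X) = h (f X)] gives two relations ([commute_lead]). When [fslope f] is
    not zero they say that [d] is 1 modulo [p] and that the ratio [v / u] of the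
    leading coefficients of [h] is [fcurv f / fslope f]; when [fslope f] is zero
    and [fcurv f] is not, they say that [d] is 2 modulo [p]. Powers of [f] and
    all their conjugates commute with a conjugate of [f], so powers of elements
    on different lines cannot agree up to conjugation, even modulo depth [d + 2]
    ([fdet_commute_eq0]).

    The first generating pair consists of an [x] of depth 1 and a [y] of depth 2,
    both of order [p] ([torsion_depth1], [torsion_depth2]). The nontrivial powers
    of [x] and [y] are already visible in the plane, so only the powers of [x * y]
    could disturb a quotient in which their two leading terms do not survive. The
    depths above 1 of these powers are 1 modulo [p]. Hence truncating so as to
    get order [p ^ n] is harmless, unless [n] is 1 modulo [p]; in that case one
    truncates one step later and factors out a central subgroup of order [p] that
    contains the powers of [x * y] of depth [n] ([quotient_seeing_powers]).

    For [p > 3] the plane has at least six lines, enough for two triples of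
    elements on six distinct lines ([beauville_large]). For [p = 3] there are
    four lines, and the second triple has to reuse the lines of [x] and [y]; it
    does so with elements [x * e] and [y * e'] that are not conjugate to [x] and
    [y] modulo depth 6 ([beauville_deep]), which is where [5 <= n] comes from. *)

(** * Coefficients of formal power series *)

Section SeriesCoefficients.
Local Open Scope ring_scope.
Variable R : comNzRingType.
Implicit Types s u v w : fps R.

Local Notation X := (@fpsX R).

Lemma fps_coefB s u n : (s - u) n = s n - u n. Proof. by []. Qed.
Lemma fps_coef0 n : (0 : fps R) n = 0. Proof. by []. Qed.
Lemma fps_coef1 n : (1 : fps R) n = (n == 0%N)%:R. Proof. by []. Qed.

Lemma fps_coef_sum I (r : seq I) (P : pred I) (F : I -> fps R) n :
  (\sum_(i <- r | P i) F i) n = \sum_(i <- r | P i) F i n.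
Proof. by elim/big_rec2: _ => // i s c _ <-. Qed.

Lemma fps_coefM2 s u :
  (s * u) 2%N = s 0%N * u 2%N + s 1%N * u 1%N + s 2%N * u 0%N.
Proof. by rewrite fps_coefM !big_ord_recl big_ord0 addr0 addrA. Qed.

Lemma fps_coefXM0 s : (X * s) 0%N = 0.
Proof. by rewrite fps_coefM0 mul0r. Qed.

Lemma fps_coefXMS s n : (X * s) n.+1 = s n.
Proof.
rewrite fps_coefM big_ord_recl mul0r add0r big_ord_recl mul1r big1.
  by rewrite addr0 /= subSS subn0.
by move=> i _; rewrite mul0r.
Qed.

Lemma fps_coefXnM m s n :
  (X ^+ m * s) n = if (n < m)%N then 0 else s (n - m)%N.
Proof.
elim: m n => [|m IHm] [|n]; rewrite ?expr0 ?mul1r ?subn0 //.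
  by rewrite exprS -mulrA fps_coefXM0.
by rewrite exprS -mulrA fps_coefXMS IHm ltnS subSS.
Qed.

Definition fps_const (c : R) : fps R := Fps (fun n => if n is 0%N then c else 0).

Fact fps_const_zmod : zmod_morphism fps_const.
Proof. by move=> a b; apply/fpsP => -[|n] //; rewrite fps_coefB /= subr0. Qed.

Lemma fps_coefCM c s n : (fps_const c * s) n = c * s n.
Proof.
rewrite fps_coefM big_ord_recl subn0 big1 ?addr0 // => i _.
by rewrite mul0r.
Qed.

Fact fps_const_monoid : GRing.monoid_morphism fps_const.
Proof.
by split=> [|a b]; apply/fpsP => -[|n] //; rewrite fps_coefCM /= ?mulr0.
Qed.

HB.instance Definition _ :=
  GRing.isZmodMorphism.Build R (fps R) fps_const fps_const_zmod.
HB.instance Definition _ :=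
  GRing.isMonoidMorphism.Build R (fps R) fps_const fps_const_monoid.

Lemma fps_head s : s = fps_const (s 0%N) + X * Fps (fun n => s n.+1).
Proof.
apply/fpsP => -[|n]; rewrite fps_coefD ?fps_coefXM0 ?addr0 //.
by rewrite fps_coefXMS add0r.
Qed.

Definition eqmodX m s u := forall i, (i < m)%N -> s i = u i.

Lemma eqmodXP m s u : eqmodX m s u <-> exists r, s = u + X ^+ m * r.
Proof.
split=> [su | [r ->] i im]; last by rewrite fps_coefD fps_coefXnM im addr0.
exists (Fps (fun n => s (n + m)%N - u (n + m)%N)); apply/fpsP => n.
rewrite fps_coefD fps_coefXnM; case: ltnP => [nm|mn]; first by rewrite addr0 su.
by rewrite /= subnK // addrC subrK.
Qed.

Lemma eqmodX_sym m s u : eqmodX m s u -> eqmodX m u s.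
Proof. by move=> su i im; rewrite su. Qed.
Lemma eqmodX_trans m s u v : eqmodX m s u -> eqmodX m u v -> eqmodX m s v.
Proof. by move=> su uv i im; rewrite su // uv. Qed.
Lemma eqmodX_leq m n s u : (m <= n)%N -> eqmodX n s u -> eqmodX m s u.
Proof. by move=> mn su i im; apply: su; apply: leq_trans im mn. Qed.

Lemma eqmodXD m s u s' u' :
  eqmodX m s u -> eqmodX m s' u' -> eqmodX m (s + s') (u + u').
Proof. by move=> su su' i im; rewrite !fps_coefD su ?su'. Qed.

Lemma eqmodXM m s u s' u' :
  eqmodX m s u -> eqmodX m s' u' -> eqmodX m (s * s') (u * u').
Proof.
move=> su su' n nm; rewrite !fps_coefM; apply: eq_bigr => i _.
by have := ltn_ord i => ni; rewrite su ?su' //; lia.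
Qed.

Lemma eqmodX_eq s u : (forall m, eqmodX m s u) -> s = u.
Proof. by move=> su; apply/fpsP => n; apply: (su n.+1). Qed.

Lemma fps_expX_inj m : injective (fun s => X ^+ m * s).
Proof.
move=> s u /(congr1 (fun t : fps R => fun n => t (n + m)%N)) su.
apply/fpsP => n; move/(congr1 (fun t => t n)): su.
by rewrite !fps_coefXnM ltnNge leq_addl /= addnK.
Qed.

Lemma fps_mul_eq0 s u : GRing.lreg (s 0%N) -> s * u = 0 -> u = 0.
Proof.
move=> s0 su0; apply/fpsP; elim/ltn_ind => n IHn; apply: s0.
have := congr1 (fun t : fps R => t n) su0.
rewrite fps_coefM big_ord_recl subn0 big1 ?addr0 => [->|i _].
  by rewrite mulr0.
by have := ltn_ord i => ni; rewrite IHn ?mulr0 //= /bump /=; lia.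
Qed.

End SeriesCoefficients.

(** * Substitution of a series without constant term *)

Section Substitution.
Local Open Scope ring_scope.
Variables (R : comNzRingType) (u : fps R).
Local Notation X := (@fpsX R).

(** If [u] has no constant term then [u ^+ i] contributes only in degrees [i]
    and above, so that the finite sum below is the whole coefficient. *)
Definition fps_subst (s : fps R) : fps R :=
  Fps (fun n => \sum_(i < n.+1) s i * (u ^+ i) n).

Hypothesis u0 : u 0%N = 0.

Lemma fps_exp_low i n : (n < i)%N -> (u ^+ i) n = 0.
Proof.
by move=> ni; rewrite (fps_split u0) exprMn fps_coefXnM ni.
Qed.

Lemma fps_exp_lead n : (u ^+ n) n = (u 1%N) ^+ n.
Proof.
rewrite (fps_split u0) exprMn fps_coefXnM ltnn subnn fps_coefXMS /=.
by elim: n => // n IHn; rewrite !exprS fps_coefM0 IHn.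
Qed.

(* Coefficients of low degree only depend on truncations of [s], for which
   substitution is the evaluation of a polynomial, hence a ring morphism. *)
Let polyE m (s : fps R) := \poly_(i < m) s i.
Let evalu (q : {poly R}) : fps R := (map_poly (@fps_const R) q).[u].

Let evalu_coef q n m : (n < m)%N ->
  evalu q n = \sum_(i < m) q`_i * (u ^+ i) n.
Proof.
move=> nm; pose M := maxn m (size q).
have sumM k : (evalu q) k = \sum_(i < M) q`_i * (u ^+ i) k.
  rewrite /evalu (@horner_coef_wide _ M); last first.
    by rewrite (leq_trans (size_poly _ _)) // leq_maxr.
  rewrite fps_coef_sum.
  by apply: eq_bigr => i _; rewrite coef_map fps_coefCM.
rewrite sumM [RHS](big_ord_widen M (fun i => q`_i * (u ^+ i) n)) ?leq_maxl //.
rewrite [RHS]big_mkcond; apply: eq_bigr => i _.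
by case: ltnP => // mi; rewrite fps_exp_low ?mulr0 // (leq_trans nm).
Qed.

Let subst_evalu (s : fps R) (q : {poly R}) n :
  (forall i, (i <= n)%N -> q`_i = s i) -> fps_subst s n = evalu q n.
Proof.
move=> qs; rewrite (evalu_coef _ (ltnSn n)); apply: eq_bigr => i _.
by rewrite qs // -ltnS.
Qed.

Let evaluM q r : evalu (q * r) = evalu q * evalu r.
Proof. by rewrite /evalu rmorphM hornerM. Qed.

Fact fps_subst_zmod : zmod_morphism fps_subst.
Proof.
move=> s t; apply/fpsP => n; rewrite fps_coefB /= -sumrB.
by apply: eq_bigr => i _; rewrite -mulrBl.
Qed.

Fact fps_subst_monoid : GRing.monoid_morphism fps_subst.
Proof.
split=> [|s t]; apply/fpsP => n.
  by rewrite (@subst_evalu _ 1) ?/evalu ?rmorph1 ?hornerC // => i _; rewrite coef1.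
have tr (v : fps R) i : (i <= n)%N -> (polyE n.+1 v)`_i = v i.
  by rewrite coef_poly ltnS => ->.
rewrite (@subst_evalu _ (polyE n.+1 s * polyE n.+1 t)) => [|i ni]; last first.
  rewrite coefM fps_coefM; apply: eq_bigr => j _; have := ltn_ord j => ji.
  by rewrite !tr //; lia.
rewrite evaluM !fps_coefM; apply: eq_bigr => i _; have := ltn_ord i => ni.
by congr (_ * _); symmetry; apply: subst_evalu => j nj; rewrite tr //; lia.
Qed.

HB.instance Definition _ :=
  GRing.isZmodMorphism.Build (fps R) (fps R) fps_subst fps_subst_zmod.
HB.instance Definition _ :=
  GRing.isMonoidMorphism.Build (fps R) (fps R) fps_subst fps_subst_monoid.

Definition fps_subst_rmorphism : {rmorphism fps R -> fps R} := fps_subst.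

Lemma fps_substX : fps_subst X = u.
Proof.
apply/fpsP => -[|n] /=; first by rewrite big_ord1 mul0r.
rewrite big_ord_recl mul0r add0r big_ord_recl /= mul1r expr1 big1 ?addr0 // => i _.
by rewrite mul0r.
Qed.

Lemma eqmodX_subst m s t : eqmodX m s t -> eqmodX m (fps_subst s) (fps_subst t).
Proof.
move=> st n nm /=; apply: eq_bigr => i _; rewrite st //.
by have := ltn_ord i; lia.
Qed.

End Substitution.

Section SubstitutionBijective.
Local Open Scope ring_scope.
Variables (F : fieldType) (u : fps F).
Hypotheses (u0 : u 0%N = 0) (u1 : u 1%N != 0).
Local Notation X := (@fpsX F).
Local Notation sub := (fps_subst u).

Lemma fps_subst_inj : injective sub.
Proof.
move=> s t st; apply/fpsP; elim/ltn_ind => n IHn.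
have := congr1 (fun v : fps F => v n) st; rewrite /= !big_ord_recr /=.
rewrite (eq_bigr (fun i : 'I_n => t i * (u ^+ i) n)) => [|i _]; last first.
  by rewrite IHn.
by move/addrI; rewrite fps_exp_lead // => /mulIf; apply; rewrite expf_neq0.
Qed.

(** Solving for the coefficients one at a time: adding [c * X ^+ m] to the
   argument changes the value first in degree [m], by [c * u 1 ^+ m]. *)
Fixpoint subst_approx (s : fps F) (m : nat) : fps F :=
  if m is m'.+1 then
    let r := subst_approx s m' in
    r + fps_const ((s m' - sub r m') / (u 1%N) ^+ m') * X ^+ m'
  else 0.

Lemma subst_approxS s m : subst_approx s m.+1 = subst_approx s m +
  fps_const ((s m - sub (subst_approx s m) m) / (u 1%N) ^+ m) * X ^+ m.
Proof. by []. Qed.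

Lemma subst_approx_le s m n : (m <= n)%N ->
  eqmodX m (subst_approx s n) (subst_approx s m).
Proof.
elim: n => [|n IHn]; first by rewrite leqn0 => /eqP ->.
rewrite leq_eqVlt => /predU1P[-> // | mn] i im.
rewrite subst_approxS fps_coefD fps_coefCM -[X ^+ n]mulr1 fps_coefXnM (leq_trans im) //.
by rewrite mulr0 addr0 IHn.
Qed.

Lemma subst_approxP s m : eqmodX m (sub (subst_approx s m)) s.
Proof.
elim: m => [|m IHm] i //; rewrite ltnS leq_eqVlt => /predU1P[->|im]; last first.
  rewrite -IHm //; apply: (@eqmodX_subst _ _ m) => //.
  exact: subst_approx_le.
set r := subst_approx s m in IHm *.
have rE (c : F) j : (j <= m)%N ->
    (r + fps_const c * X ^+ m) j = r j + c * (j == m)%:R.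
  move=> im; rewrite fps_coefD fps_coefCM -[X ^+ m]mulr1 fps_coefXnM ltnNge.
  rewrite leq_eqVlt eq_sym; case: eqVneq => [->|_] /=; first by rewrite subnn.
  by rewrite ltnNge im.
rewrite subst_approxS -/r; set c := _ / _.
have -> : sub (r + fps_const c * X ^+ m) m = sub r m + c * (u 1%N) ^+ m.
  rewrite -[LHS]/(\sum_(i < m.+1) (r + fps_const c * X ^+ m) i * (u ^+ i) m).
  rewrite (eq_bigr (fun j : 'I_m.+1 =>
    r j * (u ^+ j) m + c * (j == m :> nat)%:R * (u ^+ j) m)) => [|j _].
    rewrite big_split /= [X in _ + X]big_ord_recr /= eqxx fps_exp_lead // mulr1.
    rewrite [X in _ + (X + _)]big1 ?add0r // => j _.
    by rewrite ltn_eqF ?ltn_ord // mulr0 mul0r.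
  by rewrite rE -?mulrDl // -ltnS.
by rewrite divfK ?expf_neq0 // subrKC.
Qed.

Lemma fps_subst_bij : bijective sub.
Proof.
have surj s : exists r, sub r = s.
  exists (Fps (fun n => subst_approx s n.+1 n)); apply: eqmodX_eq => m n nm.
  rewrite -(subst_approxP s nm); apply: (@eqmodX_subst _ _ m) => // i im /=.
  by symmetry; apply: (@subst_approx_le _ i.+1).
pose g s := projT1 (cid (surj s)).
have gK : cancel g sub by move=> s; rewrite /g; case: cid.
by exists g => // s; apply: fps_subst_inj; rewrite gK.
Qed.

End SubstitutionBijective.

(** * Automorphisms and their action modulo powers of the variable *)

Section Automorphisms.
Local Open Scope ring_scope.
Variable p : nat.
Local Notation P := (fps 'F_p).
Local Notation X := (@fpsX 'F_p).
Local Notation N := (nottingham p).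
Implicit Types (f g h : N) (s t : P).

Lemma nott_mulE f g s : (f * g)%g s = f (g s). Proof. by []. Qed.
Lemma nott_oneE s : (1%g : N) s = s. Proof. by []. Qed.

Lemma nottD f s t : f (s + t) = f s + f t. Proof. exact: rmorphD. Qed.

Lemma nott_const f c : f (fps_const c) = fps_const c.
Proof. by rewrite -[c]natr_Zp !rmorph_nat. Qed.

Lemma nott_X f : exists2 A : P, f X = X * A & A 0%N = 1.
Proof.
have [_ _ _ f0 f1] := nottinghamP f.
exists (Fps (fun n => f X n.+1)); last by [].
exact: fps_split.
Qed.

Lemma nott_eqmodX f m s t : eqmodX m s t -> eqmodX m (f s) (f t).
Proof.
move=> /eqmodXP[r ->]; apply/eqmodXP; have [A fX _] := nott_X f.
by exists (A ^+ m * f r); rewrite rmorphD rmorphM rmorphXn /= fX exprMn -mulrA.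
Qed.

(** Splitting off the constant term of a series, [s = c + X * s'], gains one
    degree of agreement at each step. *)
Lemma nott_eqmodX_fun f g m s :
  eqmodX m (f X) (g X) -> eqmodX m (f s) (g s).
Proof.
move=> fg; have [A fX _] := nott_X f.
suff H j : (j <= m)%N -> forall t, eqmodX j (f t) (g t) by apply: H.
elim: j => [|j IHj] jm t //.
rewrite (fps_head t) !rmorphD !rmorphM /= !nott_const.
apply: eqmodXD => //; set t' := Fps _.
apply: (@eqmodX_trans _ _ _ (f X * g t')); last first.
  by apply: eqmodXM => //; apply: eqmodX_leq fg.
have /eqmodXP[r ->] := IHj (ltnW jm) t'.
apply/eqmodXP; exists (A * r); rewrite fX exprS; ring.
Qed.

Lemma nott_ext f g : f X = g X -> f = g.
Proof.
move=> fg; apply/val_inj/funext => s; apply: eqmodX_eq => m.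
by apply: nott_eqmodX_fun; rewrite fg.
Qed.

Lemma nott_of_series (u : P) : u 0%N = 0 -> u 1%N = 1 -> exists f : N, f X = u.
Proof.
move=> u0 u1.
suff sP : `[< normalised_automorphism (fps_subst u) >].
  by exists (Nottingham sP); apply: fps_substX.
apply/asboolP; split; rewrite ?fps_substX //.
- exact: fps_subst_zmod.
- exact: fps_subst_monoid.
- by apply: fps_subst_bij; rewrite ?u1 ?oner_eq0.
Qed.

(** Depths are counted so that every element has depth at least 1. *)
Definition depth_ge k f := eqmodX k.+1 (f X) X.

Lemma depth_geP k f : depth_ge k f <-> exists U : P, f X = X + X ^+ k.+1 * U.
Proof. exact: eqmodXP. Qed.

Lemma depth_ge1 f : depth_ge 1 f.
Proof.
have [_ _ _ f0 f1] := nottinghamP f.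
by move=> [|[|i]] // _; rewrite ?f0 ?f1.
Qed.

Lemma depth_ge_leq j k f : (j <= k)%N -> depth_ge k f -> depth_ge j f.
Proof. by move=> jk; apply: eqmodX_leq. Qed.

Lemma nott_shift0 k f (U : P) s : f X = X + X ^+ k.+1 * U ->
  exists2 R : P, f s = s + X ^+ k.+1 * R & R 0%N = U 0%N * s 1%N.
Proof.
move=> fX; have fk : depth_ge k f by apply/depth_geP; exists U.
set s' := Fps (fun n => s n.+1).
have /eqmodXP[R' fs'] : eqmodX k.+1 (f s') s' by apply: (nott_eqmodX_fun (g := 1%g)).
exists (U * s' + X * (R' + X ^+ k * U * R')).
  rewrite {1 2}(fps_head s) -/s' rmorphD rmorphM /= nott_const fX fs' !exprS; ring.
by rewrite fps_coefD fps_coefXM0 addr0 fps_coefM0.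
Qed.

Lemma one_plus_Xn_exp i (U : P) k : (0 < i)%N ->
  exists B : P, [/\ (1 + X ^+ i * U) ^+ k = 1 + X ^+ i * B,
    B 0%N = k%:R * U 0%N
  & B 1%N = k%:R * U 1%N + (if i == 1%N then 'C(k, 2)%:R * U 0%N ^+ 2 else 0)].
Proof.
move=> i0; elim: k => [|k [B [kB B0 B1]]].
  exists 0; rewrite expr0 mulr0 addr0 bin0n !mul0r fps_coef0 !add0r; split=> //.
  by case: ifP.
exists (U + B + X * (X ^+ i.-1 * (U * B))); split.
- have e : X ^+ i = X * X ^+ i.-1 by rewrite -exprS prednK.
  by rewrite exprS kB e; ring.
- by rewrite !fps_coefD fps_coefXM0 B0 addr0; ring.
- rewrite !fps_coefD fps_coefXMS fps_coefXnM B1 fps_coefM0 B0 binS bin1 natrD.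
  by case: i i0 {kB B1} => [|[|i]] //= _; ring.
Qed.

(** The two leading coefficients by which an automorphism moves a multiple of
    [X ^+ k]: all that is said below on commutators and centralisers comes from
    comparing them. *)
Lemma nott_shift i k f (U V : P) : (0 < i)%N -> f X = X + X ^+ i.+1 * U ->
  exists S : P, [/\ f (X ^+ k * V) = X ^+ k * V + X ^+ (k + i) * S,
    S 0%N = k%:R * U 0%N * V 0%N
  & S 1%N = (k.+1)%:R * U 0%N * V 1%N + (k%:R * U 1%N +
      (if i == 1%N then 'C(k, 2)%:R * U 0%N ^+ 2 else 0)) * V 0%N].
Proof.
move=> i0 fX; have [B [kB B0 B1]] := one_plus_Xn_exp U k i0.
have [R fV R0] := nott_shift0 V fX.
exists (B * V + X * (R + X ^+ i * B * R)); split.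
- have fX' : f X = X * (1 + X ^+ i * U) by rewrite fX exprS; ring.
  by rewrite rmorphM rmorphXn /= fX' exprMn kB fV exprD exprS; ring.
- by rewrite fps_coefD fps_coefXM0 fps_coefM0 B0 addr0.
- rewrite fps_coefD fps_coefXMS fps_coefD fps_coefM1 B0 B1 R0.
  have -> : (X ^+ i * B * R) 0%N = 0 by rewrite -mulrA fps_coefXnM i0.
  rewrite -natr1; ring.
Qed.

End Automorphisms.

(** * Depth, coordinates modulo depth 3, and commutators *)

Section Depth.
Local Open Scope ring_scope.
Variable p : nat.
Local Notation P := (fps 'F_p).
Local Notation X := (@fpsX 'F_p).
Local Notation N := (nottingham p).
Implicit Types (f g h : N) (s t : P).

Lemma depth_ge_tail k f : (0 < k)%N -> depth_ge k f ->
  exists U : P, [/\ f X = X + X ^+ k.+1 * U, U 0%N = f X k.+1 & U 1%N = f X k.+2].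
Proof.
move=> k0 /depth_geP[U fX]; exists U; rewrite fX !fps_coefD !fps_coefXnM.
have -> : X k.+1 = 0 by case: k k0 {fX}.
by rewrite ltnn subnn ltnNge leqnSn subSnn /= !add0r.
Qed.

Lemma depth_geM k f g : depth_ge k f -> depth_ge k g -> depth_ge k (f * g)%g.
Proof. by move=> fk gk; exact: (eqmodX_trans (nott_eqmodX f gk) fk). Qed.

Lemma depth_geV k f : depth_ge k f -> depth_ge k f^-1%g.
Proof.
move=> fk; apply: eqmodX_sym; have := nott_eqmodX (f^-1)%g fk.
by rewrite -nott_mulE mulVg.
Qed.

Lemma depth_geX k f n : depth_ge k f -> depth_ge k (f ^+ n)%g.
Proof. by move=> fk; elim: n => [|n IHn] //; rewrite expgS; apply: depth_geM. Qed.

Lemma depth_ge_div k f g :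
  depth_ge k (f^-1 * g)%g <-> eqmodX k.+1 (g X) (f X).
Proof.
split=> [fg | gf]; last first.
  by have := nott_eqmodX (f^-1)%g gf; rewrite -!nott_mulE mulVg.
by have := nott_eqmodX f fg; rewrite -!nott_mulE mulKVg.
Qed.

Lemma nott_mul_coef k f g i : depth_ge k f -> depth_ge k g -> (0 < k)%N ->
  (1 < i)%N -> (i <= k.*2)%N -> (f * g)%g X i = f X i + g X i.
Proof.
move=> fk gk k0 i1 ik.
have [U [fX _ _]] := depth_ge_tail k0 fk; have [V [gX _ _]] := depth_ge_tail k0 gk.
have [S [fV _ _]] := nott_shift k.+1 V k0 fX.
have -> : g X i = (X ^+ k.+1 * V) i.
  by rewrite gX fps_coefD; case: i i1 {ik} => [|[|i]] //= _; rewrite add0r.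
rewrite nott_mulE gX nottD fV !fps_coefD [(X ^+ (_ + _) * _) i]fps_coefXnM.
by rewrite ifT ?addr0 //; lia.
Qed.

(** Together with [fslope], an additive coordinate on the quotient by the
    automorphisms of depth 3: for [1 / f X = 1 / X - a - l * X - ...] they are
    the coefficients [a] and [l]. *)
Definition fslope f : 'F_p := f X 2%N.
Definition fcurv f : 'F_p := f X 3%N - f X 2%N ^+ 2.

Lemma fslopeM f g : fslope (f * g)%g = fslope f + fslope g.
Proof. by apply: (@nott_mul_coef 1) => //; apply: depth_ge1. Qed.

Lemma fcurvM f g : fcurv (f * g)%g = fcurv f + fcurv g.
Proof.
have [U [fX U0 _]] := depth_ge_tail (ltn0Sn 0) (depth_ge1 f).
have [V [gX V0 V1]] := depth_ge_tail (ltn0Sn 0) (depth_ge1 g).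
have [S [fV S0 _]] := nott_shift 2 V (ltn0Sn 0) fX.
have c3 : (f * g)%g X 3%N = f X 3%N + g X 3%N + 2%:R * f X 2%N * g X 2%N.
  rewrite nott_mulE [in LHS]gX nottD fV !fps_coefD !fps_coefXnM /=.
  by rewrite -[(3 - 2)%N]/1%N -[(3 - (2 + 1))%N]/0%N S0 V1 U0 V0 addrA.
have := fslopeM f g; rewrite /fcurv /fslope c3 => ->; ring.
Qed.

Lemma fslope1 : fslope (1%g : N) = 0. Proof. by []. Qed.
Lemma fcurv1 : fcurv (1%g : N) = 0. Proof. by rewrite /fcurv /= expr0n subrr. Qed.

Lemma fslopeX f n : fslope (f ^+ n)%g = n%:R * fslope f.
Proof.
elim: n => [|n IHn]; first by rewrite mul0r fslope1.
by rewrite expgS fslopeM IHn -natr1; ring.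
Qed.

Lemma fcurvX f n : fcurv (f ^+ n)%g = n%:R * fcurv f.
Proof.
elim: n => [|n IHn]; first by rewrite mul0r fcurv1.
by rewrite expgS fcurvM IHn -natr1; ring.
Qed.

Lemma fslopeV f : fslope (f^-1)%g = - fslope f.
Proof. by apply/eqP; rewrite -addr_eq0 -fslopeM mulVg fslope1. Qed.

Lemma fcurvV f : fcurv (f^-1)%g = - fcurv f.
Proof. by apply/eqP; rewrite -addr_eq0 -fcurvM mulVg fcurv1. Qed.

Lemma fslopeJ f g : fslope (f ^ g)%g = fslope f.
Proof. by rewrite !fslopeM fslopeV; ring. Qed.

Lemma fcurvJ f g : fcurv (f ^ g)%g = fcurv f.
Proof. by rewrite !fcurvM fcurvV; ring. Qed.

Lemma eqmodX4_fslope f g : eqmodX 4 (f X) (g X) -> fslope f = fslope g.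
Proof. exact. Qed.

Lemma eqmodX4_fcurv f g : eqmodX 4 (f X) (g X) -> fcurv f = fcurv g.
Proof. by move=> fg; rewrite /fcurv !fg. Qed.

Lemma fcurv_depth2 f : fslope f = 0 -> fcurv f = f X 3%N.
Proof. by rewrite /fslope /fcurv => ->; rewrite expr0n subr0. Qed.

Lemma fslope0_depth2 f : fslope f = 0 -> depth_ge 2 f.
Proof.
by move=> f0 [|[|[|i]]] // _; apply: (depth_ge1 f).
Qed.

(** The obstruction to commuting in depth [i + j] is that of the vector fields
    [X ^+ i.+1 d/dX] and [X ^+ j.+1 d/dX], whose bracket carries the factor
    [j - i]. *)
Lemma nott_comm i j f g : (0 < i)%N -> (0 < j)%N ->
  depth_ge i f -> depth_ge j g ->
  exists S : P, (f * g)%g X = (g * f)%g X + X ^+ (i + j).+1 * S /\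
    S 0%N = (j%:R - i%:R) * f X i.+1 * g X j.+1.
Proof.
move=> i0 j0 fi gj; have [U [fX <- _]] := depth_ge_tail i0 fi.
have [V [gX <- _]] := depth_ge_tail j0 gj.
have [S [fV S0 _]] := nott_shift j.+1 V i0 fX.
have [T [gU T0 _]] := nott_shift i.+1 U j0 gX.
exists (S - T); split; last by rewrite fps_coefB S0 T0 -!natr1; ring.
rewrite !nott_mulE [in LHS]gX [in RHS]fX !nottD fV gU fX gX.
by rewrite !addSn addnC; ring.
Qed.

Lemma depth_ge_comm i j f g : (0 < i)%N -> (0 < j)%N ->
  depth_ge i f -> depth_ge j g ->
  depth_ge (i + j) [~ f, g]%g /\
  [~ f, g]%g X (i + j).+1 = (j%:R - i%:R) * f X i.+1 * g X j.+1.
Proof.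
move=> i0 j0 fi gj; have [S [fg S0]] := nott_comm i0 j0 fi gj.
have RX : [~ f, g]%g X = X + ((f^-1 * g^-1)%g (X ^+ (i + j).+1 * S)).
  have -> : [~ f, g]%g = (f^-1 * g^-1 * (f * g))%g by rewrite /commg !mulgA.
  rewrite nott_mulE fg nottD -nott_mulE; congr (_ + _).
  by rewrite !mulgA mulgKV mulVg.
have [U [hX _ _]] := depth_ge_tail (ltn0Sn 0) (depth_ge1 (f^-1 * g^-1)%g).
have [T [hS _ _]] := nott_shift (i + j).+1 S (ltn0Sn 0) hX.
have RX' : [~ f, g]%g X = X + X ^+ (i + j).+1 * (S + X * T).
  by rewrite RX hS exprD; ring.
split; first by apply/depth_geP; exists (S + X * T).
rewrite RX' fps_coefD fps_coefXnM ltnn subnn fps_coefD fps_coefXM0 S0 addr0.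
have -> : X (i + j).+1 = 0 by rewrite /= eqSS addn_eq0 (gtn_eqF i0).
exact: add0r.
Qed.

(** The coefficients of [X ^+ d.+2] and [X ^+ d.+3] in [f (h X) = h (f X)]. The
    third coefficient of [h] enters the latter equally on both sides. *)
Lemma commute_lead d f h : (1 < d)%N -> commute f h -> depth_ge d h ->
  (d%:R - 1) * fslope f * h X d.+1 = 0 /\
  d%:R * fslope f * h X d.+2 + (d%:R - 2%:R) * f X 3%N * h X d.+1
    + 'C(d.+1, 2)%:R * fslope f ^+ 2 * h X d.+1 = 0.
Proof.
rewrite /fslope => d1 fh hd; have d0 : (0 < d)%N by apply: ltnW.
have [U [hX <- <-]] := depth_ge_tail d0 hd.
have [A [fX <- <-]] := depth_ge_tail (ltn0Sn 0) (depth_ge1 f).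
have [S [fU S0 S1]] := nott_shift d.+1 U (ltn0Sn 0) fX.
have [T [hA T0 T1]] := nott_shift 2 A d0 hX.
have ST : S = T.
  apply: (@fps_expX_inj _ d.+2); have /(congr1 (fun k : N => k X)) := fh.
  rewrite /= [in X in X = _]hX [in X in _ = X]fX !nottD fU hA fX hX => e.
  rewrite add2n addn1 in e; apply: (addrI (X + X ^+ 2 * A + X ^+ d.+1 * U)).
  by rewrite -addrA e; ring.
move: S0 S1; rewrite ST T0 T1 /= (gtn_eqF d1) addr0 => e0 e1; split.
  by apply: (addrI (2%:R * U 0%N * A 0%N)); rewrite addr0 [in RHS]e0 -natr1; ring.
apply: (addrI (3%:R * U 0%N * A 1%N + 2%:R * U 1%N * A 0%N)).
by rewrite addr0 [in RHS]e1 -!natr1; ring.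
Qed.

End Depth.

(** * Elements of order p of depths 1 and 2 *)

Section SquareRoot.
Local Open Scope ring_scope.
Variable F : fieldType.
Local Notation X := (@fpsX F).

Lemma fps_geom : Fps (fun=> 1) * (1 - X) = 1 :> fps F.
Proof.
rewrite mulrBr mulr1 [_ * X]mulrC; apply/fpsP => -[|n].
  by rewrite fps_coefB fps_coefXM0 subr0.
by rewrite fps_coefB fps_coefXMS subrr.
Qed.

(** Newton's binomial square root, obtained by inverting the substitution
    [X |-> (1 + X) ^ 2 - 1]. *)
Lemma fps_sqrt (s : fps F) : 2%:R != 0 :> F -> s 0%N = 1 ->
  exists2 A : fps F, A ^+ 2 = s & A 0%N = 1.
Proof.
move=> two0 s0; pose u : fps F := 2%:R * X + X ^+ 2.
have u0 : u 0%N = 0 by rewrite fps_coefD fps_coefM0 mulr0 fps_coefM0 mul0r addr0.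
have u1 : u 1%N = 2%:R.
  by rewrite fps_coefD !fps_coefM1 fps_coef_nat /= !mul0r !mulr0 !addr0 mulr1.
have [g _ gK] := fps_subst_bij u0 (etrans (congr1 (fun c => c != 0) u1) two0).
have rX := gK X; set r := g X in rX.
have r0 : r 0%N = 0.
  have := congr1 (fun t : fps F => t 0%N) rX.
  by rewrite /= big_ord1 expr0 mulr1.
have r2 : (1 + r) ^+ 2 = 1 + X.
  apply: (fps_subst_inj u0); first by rewrite u1.
  rewrite -[LHS]/(fps_subst_rmorphism u0 _) -[RHS]/(fps_subst_rmorphism u0 _).
  rewrite rmorphXn !rmorphD rmorph1 /= rX fps_substX // /u; ring.
have v0 : (s - 1) 0%N = 0 by rewrite fps_coefB s0 subrr.
exists (fps_subst_rmorphism v0 (1 + r)).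
  by rewrite -rmorphXn r2 rmorphD rmorph1 /= fps_substX // addrC subrK.
by rewrite /= big_ord1 expr0 mulr1 r0 addr0.
Qed.

Lemma fps_sqr_eq1 (s : fps F) : 2%:R != 0 :> F -> s 0%N = 1 -> s ^+ 2 = 1 -> s = 1.
Proof.
move=> two0 s0 s2; apply/eqP; rewrite -subr_eq0; apply/eqP.
apply: (@fps_mul_eq0 _ (s + 1)).
  by apply/lregP; rewrite fps_coefD s0.
by rewrite mulrC -subr_sqr_1 s2 subrr.
Qed.

End SquareRoot.

Section TorsionElements.
Local Open Scope ring_scope.
Variable p : nat.
Hypotheses (p_pr : prime p) (p_odd : odd p).
Local Notation P := (fps 'F_p).
Local Notation X := (@fpsX 'F_p).
Local Notation N := (nottingham p).

Lemma Fp_nat_eq0 n : (n%:R == 0 :> 'F_p) = (p %| n)%N.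
Proof. by rewrite (dvdn_pcharf (pchar_Fp p_pr)). Qed.

Lemma Fp_two_neq0 : 2%:R != 0 :> 'F_p.
Proof.
rewrite Fp_nat_eq0 dvdn_prime2 //; apply: contraTN p_odd => /eqP ->; exact: isT.
Qed.

Lemma fps_p_eq0 : p%:R = 0 :> P.
Proof. by rewrite -(rmorph_nat (@fps_const 'F_p)) pchar_Fp_0 // rmorph0. Qed.

(** The Moebius map [X / (1 - X)], whose [k]-th power is [X / (1 - k X)]. *)
Lemma torsion_depth1 : exists x : N,
  [/\ (x ^+ p = 1)%g, fslope x = 1 & fcurv x = 0].
Proof.
pose u : P := Fps (fun n => (0 < n)%:R).
have [//|//|x xX] := @nott_of_series p u.
exists x; rewrite /fslope /fcurv xX /= expr1n subrr; split=> //.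
have uE : u * (1 - X) = X.
  rewrite mulrBr mulr1 [_ * X]mulrC; apply/fpsP => -[|n].
    by rewrite fps_coefB fps_coefXM0 subr0.
  by rewrite fps_coefB fps_coefXMS; case: n => [|n]; rewrite /= ?subr0 ?subrr.
have xk k : (x ^+ k)%g X * (1 - k%:R * X) = X.
  elim: k => [|k IHk]; first by rewrite mul0r subr0 mulr1.
  have := congr1 x IHk; rewrite rmorphM rmorphB rmorph1 rmorphM rmorph_nat /= xX.
  rewrite -nott_mulE -expgS => /(congr1 (fun s => s * (1 - X))).
  rewrite uE => e; rewrite -[RHS]e -mulrA; congr (_ * _).
  rewrite mulrBl mul1r -mulrA uE -natr1; ring.
by apply: nott_ext; have := xk p; rewrite fps_p_eq0 mul0r subr0 mulr1.
Qed.

(** The conjugate [X / sqrt (1 - 2 X ^ 2)] of a Moebius map by the (non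
    bijective) substitution [X |-> X ^ 2]. *)
Lemma torsion_depth2 : exists y : N,
  [/\ (y ^+ p = 1)%g, fslope y = 0 & fcurv y = 1].
Proof.
pose v : P := 2%:R * X ^+ 2.
have v0 : v 0%N = 0 by rewrite fps_coefM0 fps_coefM0 mul0r mulr0.
pose w : P := fps_subst_rmorphism v0 (Fps (fun=> 1)).
have wE : w * (1 - v) = 1.
  have := congr1 (fps_subst_rmorphism v0) (fps_geom 'F_p).
  by rewrite rmorphM rmorphB rmorph1 /= fps_substX.
have [|A AE A0] := fps_sqrt Fp_two_neq0 (_ : w 0%N = 1).
  by rewrite /w /= big_ord1 expr0 mulr1.
have [||y yX] := @nott_of_series p (X * A).
- exact: fps_coefXM0.
- by rewrite fps_coefXMS.
have AE' : A ^+ 2 * (1 - v) = 1 by rewrite AE.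
have two0 := Fp_two_neq0.
have v1 : v 1%N = 0.
  by rewrite /v expr2 mulrCA fps_coefXMS mulrC fps_coefXM0.
have v2 : v 2%N = 2%:R.
  by rewrite /v expr2 mulrCA fps_coefXMS mulrC fps_coefXMS fps_coef_nat.
have A1 : A 1%N = 0.
  have := congr1 (fun s : P => s 1%N) AE'.
  rewrite fps_coefM1 expr2 fps_coefM0 fps_coefM1 !fps_coefB A0 v0 v1.
  rewrite !fps_coef1 /= => e.
  by apply: (mulfI two0); rewrite mulr0 -[RHS]e; ring.
have A2 : A 2%N = 1.
  have := congr1 (fun s : P => s 2%N) AE'.
  rewrite fps_coefM2 expr2 fps_coefM0 fps_coefM1 fps_coefM2 !fps_coefB A0 A1 v0 v1 v2.
  rewrite !fps_coef1 /= => e; apply: (mulfI two0); apply/eqP.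
  by rewrite -subr_eq0; apply/eqP; rewrite -[RHS]e; ring.
exists y; rewrite /fslope /fcurv yX !fps_coefXMS A1 A2 expr0n subr0; split=> //.
have yk k : ((y ^+ k)%g X) ^+ 2 * (1 - k%:R * v) = X ^+ 2.
  elim: k => [|k IHk]; first by rewrite mul0r subr0 mulr1.
  have vE : y v = A ^+ 2 * v.
    by rewrite /v rmorphM rmorphXn rmorph_nat /= yX; ring.
  have := congr1 y IHk.
  rewrite rmorphM rmorphXn rmorphB rmorph1 rmorphM rmorph_nat rmorphXn /= yX vE.
  rewrite -nott_mulE -expgS => /(congr1 (fun s => s * (1 - v))).
  rewrite exprMn -[RHS]mulrA AE' mulr1 => <-.
  rewrite -[RHS]mulrA; congr (_ * _).
  rewrite -natr1 mulrBl mul1r.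
  have -> : k%:R * (A ^+ 2 * v) * (1 - v) = k%:R * v * (A ^+ 2 * (1 - v)) by ring.
  by rewrite AE'; ring.
have [B BX B0] := nott_X (y ^+ p)%g.
apply: nott_ext; rewrite nott_oneE BX; have := yk p.
rewrite fps_p_eq0 mul0r subr0 mulr1 BX exprMn => B2.
have {}B2 : B ^+ 2 = 1 by apply: (@fps_expX_inj _ 2); rewrite mulr1.
by rewrite (fps_sqr_eq1 two0 B0 B2) mulr1.
Qed.

End TorsionElements.

(** * Finite quotients *)

Section FiniteQuotients.
Local Open Scope group_scope.

Section KeyQuotient.
Variables (G : groupType) (T : finType) (key : G -> T) (lift : T -> G).
Hypothesis liftK : cancel lift key.
Hypothesis keyM : forall f f' g g',
  key f = key f' -> key g = key g' -> key (f * g) = key (f' * g').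

(** The group law on [T] depends on the data of the section; mentioning the two
    hypotheses makes them parameters of the type that carries it. *)
Definition key_quotient : Type := let _ := (liftK, keyM) in T.
HB.instance Definition _ := Finite.copy key_quotient T.

Let mul (a b : key_quotient) : key_quotient := key (lift a * lift b).
Let inv (a : key_quotient) : key_quotient := key (lift a)^-1.
Let one : key_quotient := key 1.

Let mulE f g : mul (key f) (key g) = key (f * g).
Proof. by apply: keyM; rewrite liftK. Qed.

Fact key_mulA : associative mul.
Proof.
move=> a b c; rewrite -(liftK a) -(liftK b) -(liftK c).
by rewrite !mulE mulgA.
Qed.

Fact key_mul1 : left_id one mul.
Proof. by move=> a; rewrite -(liftK a) mulE mul1g. Qed.

Fact key_mulV : left_inverse one inv mul.
Proof. by move=> a; rewrite -[in X in mul _ X](liftK a) /inv mulE mulVg. Qed.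

HB.instance Definition _ :=
  Finite_isGroup.Build key_quotient key_mulA key_mul1 key_mulV.

Definition key_proj (f : G) : key_quotient := key f.

Fact key_projM : {morph key_proj : x y / x * y}.
Proof. by move=> f g; exact: (esym (mulE f g)). Qed.

HB.instance Definition _ :=
  isMultiplicative.Build G key_quotient key_proj key_projM.
HB.instance Definition _ := Multiplicative_isUMagmaMorphism.Build
  G key_quotient key_proj (erefl : key_proj 1 = 1).

Lemma key_proj_surj (y : key_quotient) : exists x, key_proj x = y.
Proof. by exists (lift y); apply: liftK. Qed.

End KeyQuotient.

Lemma cyclic_quotient (G : groupType) (gT : finGroupType)
    (phi : UMagmaMorphism.type G gT) (e : G) :
    (forall y, exists x, phi x = y) -> (forall f, commute (phi f) (phi e)) ->
  exists (hT : finGroupType) (psi : UMagmaMorphism.type G hT),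
    [/\ forall y, exists x, psi x = y, (#|hT| * #[phi e] = #|gT|)%N
      & forall f, psi f = 1 <-> exists k, phi f = phi (e ^+ k)].
Proof.
move=> surj cent; pose W := <[phi e]>%G.
have nW u : u \in 'N(W).
  have [f <-] := surj u; apply: (subsetP (cent_sub _)).
  by rewrite cent_cycle; apply/cent1P; exact: cent.
pose psi0 (f : G) : coset_of W := coset W (phi f).
have psiM : {morph psi0 : x y / x * y}.
  by move=> x y; rewrite /psi0 gmulfM coset_morphM.
have psi1 : psi0 1 = 1 by rewrite /psi0 gmulf1 morph1.
pose mixM := isMultiplicative.Build G (coset_of W) psi0 psiM.
pose mix1 := Multiplicative_isUMagmaMorphism.Build G (coset_of W) psi0 psi1.
pose psi : UMagmaMorphism.type G (coset_of W) := HB.pack psi0 mixM mix1.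
exists (coset_of W), psi; split.
- move=> y; have [u _ ->] := cosetP y; have [f <-] := surj u.
  by exists f.
- rewrite -(@cardsT (coset_of W)) -quotientT card_quotient; last first.
    by apply/subsetP => u _; apply: nW.
  by rewrite mulnC Lagrange ?subsetT // cardsT.
- move=> f; split=> [f1 | [k fk]].
    have /cycleP[k fk] : phi f \in W by apply: coset_idr f1.
    by exists k; rewrite gmulfXn.
  by apply: coset_id; rewrite fk gmulfXn mem_cycle.
Qed.

End FiniteQuotients.

Section Truncations.
Variables (p n : nat).
Hypothesis p_pr : prime p.
Local Notation P := (fps 'F_p).
Local Notation X := (@fpsX 'F_p).
Local Notation N := (nottingham p).

Local Open Scope ring_scope.

Let key (f : N) : {ffun 'I_n -> 'F_p} := [ffun i : 'I_n => f X i.+2].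

Let keyP f g : key f = key g <-> eqmodX n.+2 (f X) (g X).
Proof.
split=> [/ffunP fg [|[|i]] im | fg].
- by rewrite !(@depth_ge1 p _ 0).
- by rewrite !(@depth_ge1 p _ 1).
- by have := fg (Ordinal (im : (i < n)%N)); rewrite !ffunE.
by apply/ffunP => i; rewrite !ffunE fg // !ltnS.
Qed.

Let lift_ex (c : {ffun 'I_n -> 'F_p}) : exists f : N, key f = c.
Proof.
pose u : P := Fps (fun i => if i is j.+2 then
  if insub j is Some k then c k else 0 else i%:R).
have [//|//|f fX] := @nott_of_series p u.
by exists f; apply/ffunP => i; rewrite ffunE fX /= valK.
Qed.

Let lift c := projT1 (cid (lift_ex c)).

Let liftK : cancel lift key.
Proof. by move=> c; rewrite /lift; case: cid. Qed.

Let keyM (f f' g g' : N) :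
  key f = key f' -> key g = key g' -> key (f * g)%g = key (f' * g')%g.
Proof.
move=> /keyP ff /keyP gg; apply/keyP; rewrite !nott_mulE.
by apply: eqmodX_trans (nott_eqmodX f' gg); apply: nott_eqmodX_fun.
Qed.

Lemma truncation_quotient : exists gT : finGroupType,
  exists phi : UMagmaMorphism.type N gT,
  [/\ forall y, exists x, phi x = y, #|gT| = (p ^ n)%N
    & forall f, phi f = 1%g <-> depth_ge n.+1 f].
Proof.
exists (key_quotient liftK keyM), (@key_proj _ _ _ _ liftK keyM).
split.
- exact: key_proj_surj.
- by rewrite [LHS](card_ffun 'I_n 'F_p) card_Fp // card_ord.
- by move=> f; apply: (@keyP f 1%g).
Qed.

End Truncations.

(** * Leading terms in the centraliser of an automorphism *)

Section CentraliserRelations.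
Local Open Scope ring_scope.
Variable p : nat.
Hypotheses (p_pr : prime p) (p_odd : odd p).
Local Notation P := (fps 'F_p).
Local Notation X := (@fpsX 'F_p).
Local Notation N := (nottingham p).
Implicit Types (f g h : N).

Lemma Fp_nat_inj m n : (m%:R = n%:R :> 'F_p) -> m = n %[mod p].
Proof. by move/(congr1 (@nat_of_ord _)); rewrite !val_Fp_nat. Qed.

Lemma nott_pow_coef k f n i : depth_ge k f -> (0 < k)%N -> (1 < i)%N ->
  (i <= k.*2)%N -> (f ^+ n)%g X i = n%:R * f X i.
Proof.
move=> fk k0 i1 ik; elim: n => [|n IHn].
  by rewrite mul0r nott_oneE; case: i i1 {ik} => [|[|i]].
rewrite expgS (nott_mul_coef fk (depth_geX n fk)) // IHn -natr1; ring.
Qed.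

Lemma nott_inv_coef k f i : depth_ge k f -> (0 < k)%N -> (1 < i)%N ->
  (i <= k.*2)%N -> (f^-1)%g X i = - f X i.
Proof.
move=> fk k0 i1 ik; apply/eqP; rewrite -addr_eq0.
rewrite -(nott_mul_coef (depth_geV fk) fk) // mulVg nott_oneE.
by case: i i1 {ik} => [|[|i]].
Qed.

Lemma depth_geS k f : (0 < k)%N -> depth_ge k f -> f X k.+1 = 0 -> depth_ge k.+1 f.
Proof.
move=> k0 fk fk0 i; rewrite ltnS leq_eqVlt => /predU1P[->|]; last exact: fk.
by rewrite fk0; case: k k0 {fk fk0}.
Qed.

Lemma exact_depth m f : ~ depth_ge m f ->
  exists d, [/\ (0 < d < m)%N, depth_ge d f & f X d.+1 != 0].
Proof.
elim: m => [|[|m] IHm] fm.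
- by case: fm; apply: depth_ge_leq (depth_ge1 f).
- by case: fm; apply: depth_ge1.
have [fm1|] := pselect (depth_ge m.+1 f).
  exists m.+1; split=> //; first by rewrite ltnSn.
  by apply/eqP => f0; apply: fm; apply: depth_geS.
by move=> /IHm[d [/andP[d0 dm] fd f0]]; exists d; split=> //; rewrite d0 ltnW.
Qed.

Lemma fcurv0_depth3 f : fslope f = 0 -> fcurv f = 0 -> depth_ge 3 f.
Proof.
move=> a0 c0; apply: depth_geS => //; first exact: fslope0_depth2.
by rewrite -fcurv_depth2.
Qed.

(** An automorphism of depth [d] commuting with [f] knows the line spanned by
    [(fslope f, fcurv f)]: either through its two leading coefficients, or, when
    that line is the vertical one, through the residue of [d] modulo [p]. *)
Lemma commute_slope d f h : (1 < d)%N -> commute f h -> depth_ge d h ->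
  h X d.+1 != 0 -> fslope f != 0 ->
  d%:R = 1 :> 'F_p /\ fslope f * h X d.+2 = fcurv f * h X d.+1.
Proof.
move=> d1 fh hd u0 a0; have [e0 e1] := commute_lead d1 fh hd.
have d1p : d%:R = 1 :> 'F_p.
  move/eqP: e0; rewrite !mulf_eq0 (negPf a0) (negPf u0) !orbF subr_eq0.
  by move/eqP.
split=> //; have bin1 : 'C(d.+1, 2)%:R = 1 :> 'F_p.
  apply: (mulfI (Fp_two_neq0 p_pr p_odd)); rewrite mulr1 -natrM -mul_bin_diag.
  by rewrite bin1 natrM -natr1 d1p mulr1.
move: e1; rewrite d1p bin1 /fcurv /fslope => e1.
by apply/eqP; rewrite -subr_eq0; apply/eqP; rewrite -[RHS]e1; ring.
Qed.

Lemma commute_vertical d f h : (1 < d)%N -> commute f h -> depth_ge d h ->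
  h X d.+1 != 0 -> fslope f = 0 -> fcurv f != 0 -> d%:R = 2%:R :> 'F_p.
Proof.
move=> d1 fh hd u0 a0 c0; have [_ e1] := commute_lead d1 fh hd.
move/eqP: e1; rewrite -fcurv_depth2 // a0 expr0n mulr0 !(mul0r, mulr0) add0r addr0.
by rewrite !mulf_eq0 (negPf c0) (negPf u0) !orbF subr_eq0 => /eqP.
Qed.

Definition fdet f g := fslope f * fcurv g - fslope g * fcurv f.

Lemma fdetJ f g h : fdet f (g ^ h)%g = fdet f g.
Proof. by rewrite /fdet fslopeJ fcurvJ. Qed.

(** The depth of [h] or the ratio of its two leading coefficients determines the
    line of [f], and the same data for [k] determine the line of [g]. *)
Lemma fdet_commute_eq0 d f g h (k : N) : (1 < d)%N -> commute f h -> commute g k ->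
  depth_ge d h -> h X d.+1 != 0 -> eqmodX d.+3 (k X) (h X) -> fdet f g = 0.
Proof.
move=> d1 fh gk hd u0 kh.
have kd : depth_ge d k := eqmodX_trans (eqmodX_leq (leq_addl 2 d.+1) kh) hd.
have ku : k X d.+1 = h X d.+1 by apply: kh; lia.
have kv : k X d.+2 = h X d.+2 by apply: kh.
have u0' : k X d.+1 != 0 by rewrite ku.
have one2 : 1 != 2%:R :> 'F_p by rewrite -subr_eq0 -opprB oppr_eq0 mulr2n addrK oner_eq0.
apply: contraNeq one2 => det0.
have [a0|a0] := eqVneq (fslope f) 0; have [b0|b0] := eqVneq (fslope g) 0.
- by move: det0; rewrite /fdet a0 b0 !mul0r subrr eqxx.
- have [e _] := commute_slope d1 gk kd u0' b0; rewrite -[X in X == _]e.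
  apply/eqP; apply: (commute_vertical d1 fh hd u0 a0).
  by apply: contraNneq det0; rewrite /fdet a0 => ->; rewrite mulr0 mul0r subrr.
- have [e _] := commute_slope d1 fh hd u0 a0; rewrite -[X in X == _]e.
  apply/eqP; apply: (commute_vertical d1 gk kd u0' b0).
  by apply: contraNneq det0; rewrite /fdet b0 => ->; rewrite mulr0 mul0r subrr.
have [_ ef] := commute_slope d1 fh hd u0 a0.
have [_] := commute_slope d1 gk kd u0' b0; rewrite ku kv => eg.
suff : fdet f g * h X d.+1 = 0.
  by move/eqP; rewrite mulf_eq0 (negPf det0) (negPf u0).
have -> : fdet f g * h X d.+1 =
    fslope f * (fcurv g * h X d.+1) - fslope g * (fcurv f * h X d.+1).
  by rewrite /fdet; ring.
by rewrite -ef -eg; ring.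
Qed.

End CentraliserRelations.

(** * Disjointness of conjugates of cyclic groups *)

Section CyclicDisjointness.
Local Open Scope group_scope.
Variable gT : finGroupType.
Implicit Types u v x y : gT.

(** It is enough to conjugate on one side, as [beauville_Sigma] is stable under
    conjugation. *)
Definition conj_disjoint u v := forall h, <[u]> :&: <[v ^ h]> \subset [1].

Lemma conj_disjointV u v : conj_disjoint u v -> conj_disjoint u v^-1.
Proof. by move=> uv h; rewrite conjVg cycleV. Qed.

Lemma beauville_setT x1 y1 x2 y2 :
    <<[set x1; y1]>> = [set: gT] -> <<[set x2; y2]>> = [set: gT] ->
    {in [:: x1; y1; x1 * y1] & [:: x2; y2; x2 * y2], forall u v,
      conj_disjoint u v} ->
  beauville_group [set: gT]%G.
Proof.
move=> gen1 gen2 disj; exists x1, y1, x2, y2; split=> //.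
have SigmaP x y e : e \in beauville_Sigma [set: gT]%G x y ->
    exists2 u, u \in [:: x; y; x * y] & exists g, e \in <[u ^ g]>.
  case/bigcupP => g _; rewrite !inE -!cycleJ => /orP[/orP[]|] eg.
  - by exists x; rewrite ?inE ?eqxx //; exists g.
  - by exists y; rewrite ?inE ?eqxx ?orbT //; exists g.
  - by exists (x * y); rewrite ?inE ?eqxx ?orbT //; exists g.
have Sigma1 x y : 1 \in beauville_Sigma [set: gT]%G x y.
  by apply/bigcupP; exists 1; rewrite ?inE ?conjsg1 ?group1.
apply/eqP; rewrite eqEsubset; apply/andP; split; last first.
  by rewrite sub1set inE !Sigma1.
apply/subsetP => e /setIP[/SigmaP[u uT [g eg]] /SigmaP[v vT [h eh]]].
have eu : e ^ g^-1 \in <[u]> by rewrite -mem_conjg -cycleJ.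
have ev : e ^ g^-1 \in <[v ^ (h * g^-1)]> by rewrite conjgM cycleJ memJ_conjg.
have /subsetP/(_ (e ^ g^-1)) := disj u v uT vT (h * g^-1).
by rewrite in_setI eu ev !inE conjg_eq1; apply.
Qed.

End CyclicDisjointness.

Section DisjointPowers.
Local Open Scope group_scope.
Variable p : nat.
Hypotheses (p_pr : prime p) (p_odd : odd p).
Local Notation P := (fps 'F_p).
Local Notation X := (@fpsX 'F_p).
Local Notation N := (nottingham p).
Implicit Types (f g h : N).

Variables (gT : finGroupType) (phi : UMagmaMorphism.type N gT).
Hypothesis phi_surj : forall y, exists x, phi x = y.

Lemma phi_eq_mod k f g : (forall h, phi h = 1 -> depth_ge k h) ->
  phi f = phi g -> eqmodX k.+1 (f X) (g X).
Proof.
move=> ker fg; apply/depth_ge_div; apply: ker.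
by rewrite gmulfM gmulfV fg mulVg.
Qed.

Lemma conj_disjoint_powers f g :
    (forall r s h, phi (f ^+ r) = phi ((g ^ h) ^+ s) -> phi (f ^+ r) = 1) ->
  conj_disjoint (phi f) (phi g).
Proof.
move=> H y; have [h <-] := phi_surj y; rewrite -gmulfJ.
apply/subsetP => _ /setIP[/cycleP[r ->] /cycleP[s]].
by rewrite -!gmulfXn inE => /H ->.
Qed.

Let powers_eq (r s : nat) f g h :
    (forall k, phi k = 1 -> depth_ge 3 k) ->
    phi (f ^+ r) = phi ((g ^ h) ^+ s) ->
  (r%:R * fslope f = s%:R * fslope g /\ r%:R * fcurv f = s%:R * fcurv g)%R.
Proof.
move=> ker /(phi_eq_mod ker) e.
split; first by have := eqmodX4_fslope e; rewrite !fslopeX fslopeJ.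
by have := eqmodX4_fcurv e; rewrite !fcurvX fcurvJ.
Qed.

Let powers_dvd (r s : nat) f g h :
    (forall k, phi k = 1 -> depth_ge 3 k) -> fdet f g != 0%R ->
  phi (f ^+ r) = phi ((g ^ h) ^+ s) -> p %| r.
Proof.
move=> ker det0 /(powers_eq ker)[ea ec].
have : (r%:R * fdet f g = 0)%R.
  have -> : (r%:R * fdet f g =
    r%:R * fslope f * fcurv g - fslope g * (r%:R * fcurv f))%R.
    by rewrite /fdet; ring.
  by rewrite ea ec; ring.
by move/eqP; rewrite mulf_eq0 (negPf det0) orbF (Fp_nat_eq0 p_pr).
Qed.

Let expg_dvd (T : groupType) (f : T) r : f ^+ p = 1 -> p %| r -> f ^+ r = 1.
Proof. by move=> fp /dvdnP[q ->]; rewrite mulnC expgnA fp expg1n. Qed.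

(** The nontrivial powers of an element of order [p] outside depth 3 are
    nontrivial in the plane, where different lines meet in 0. *)
Lemma torsion_disjoint f g : (forall k, phi k = 1 -> depth_ge 3 k) ->
  f ^+ p = 1 -> fdet f g != 0%R -> conj_disjoint (phi f) (phi g).
Proof.
move=> ker fp det0; apply: conj_disjoint_powers => r s h e.
by rewrite (expg_dvd fp (powers_dvd ker det0 e)) gmulf1.
Qed.

(** Every power of [f] that survives in the quotient does so together with its
    two leading terms. *)
Definition powers_seen f := forall r, phi (f ^+ r) != 1 ->
  exists d, [/\ 0 < d, depth_ge d (f ^+ r), (f ^+ r) X d.+1 != 0%R
    & forall k, phi k = 1 -> depth_ge d.+2 k].

(** Depth 1 is decided in the plane, larger depths by the centralisers. *)
Lemma seen_disjoint f g : powers_seen f -> fdet f g != 0%R ->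
  conj_disjoint (phi f) (phi g).
Proof.
move=> seen det0; apply: conj_disjoint_powers => r s h e.
apply/eqP; case: (boolP (_ == _)) => // /seen[d [d0 fd f0 ker]].
case: d d0 fd f0 ker => [|[|d]] // _ fd f0 ker.
  have := powers_dvd ker det0 e; rewrite -(Fp_nat_eq0 p_pr) => r0.
  by move: (f0 : fslope (f ^+ r) != 0%R); rewrite fslopeX (eqP r0) mul0r eqxx.
have := phi_eq_mod ker e => /eqmodX_sym gf.
have := fdet_commute_eq0 p_pr p_odd _ _ _ fd f0 gf.
move=> /(_ f (g ^ h)); rewrite fdetJ => det1.
by move: det0; rewrite det1 ?eqxx //; apply: commuteX.
Qed.

(** If [f ^+ r] is a conjugate of [g ^+ s] with [r] prime to [p], then [s] is [r]
    modulo [p], because [f] and [g] agree in the plane, and the [p]-element [g]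
    has order [p] as well; extracting the [r]-th power makes [f] and [g]
    conjugate. *)
Lemma nonconj_disjoint n f g : #|gT| = (p ^ n)%N ->
    (forall k, phi k = 1 -> depth_ge 3 k) ->
    f ^+ p = 1 -> (fslope f != 0)%R || (fcurv f != 0)%R ->
    fslope g = fslope f -> fcurv g = fcurv f ->
    (forall h, phi f <> phi (g ^ h)) ->
  conj_disjoint (phi f) (phi g).
Proof.
move=> cardT ker fp f0 ga gc nconj; apply: conj_disjoint_powers => r s h e.
have [/(expg_dvd fp)-> | rp] := boolP (p %| r); first exact: gmulf1.
case: (nconj h).
have [ea ec] := powers_eq ker e; rewrite ga gc in ea ec.
have rs : (r%:R = s%:R :> 'F_p)%R.
  by case/orP: f0 => f0; [apply: (mulIf f0 ea) | apply: (mulIf f0 ec)].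
have sp : ~~ (p %| s) by rewrite -(Fp_nat_eq0 p_pr) -rs (Fp_nat_eq0 p_pr).
rewrite !gmulfXn in e; set t := phi (g ^ h) in e *; set q := phi f in e *.
have qp : q ^+ p = 1 by rewrite /q -gmulfXn fp gmulf1.
have tp : t ^+ p = 1.
  have : #[t] %| s * p.
    by rewrite order_dvdn expgnA -e -expgnA mulnC expgnA qp expg1n.
  have /dvdn_pfactor[//|j _ oj] : #[t] %| p ^ n by rewrite -cardT -cardsT order_dvdG ?inE.
  rewrite Gauss_dvdr; first by rewrite order_dvdn => /eqP.
  by rewrite oj coprimeXl // prime_coprime.
(* An inverse of [r] modulo [p], hence of [s] as well. *)
pose r' : nat := nat_of_ord ((r%:R : 'F_p)^-1)%R.
have r'E : (r%:R * r'%:R = 1 :> 'F_p)%R.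
  by rewrite /r' natr_Zp mulfV // (Fp_nat_eq0 p_pr).
have inv (a : nat) (w : gT) : (a%:R = r%:R :> 'F_p)%R -> w ^+ p = 1 -> w ^+ (a * r') = w.
  move=> ar wp; have am : a * r' = 1 %[mod p].
    by apply: (Fp_nat_inj p_pr); rewrite natrM ar r'E.
  by rewrite -(expg_mod _ wp) am (expg_mod _ wp) expg1.
by rewrite -(inv r q) // -(inv s t) // !expgnA e.
Qed.

End DisjointPowers.

(** * Non-conjugate elements with the same coordinates *)

Section NonConjugate.
Local Open Scope ring_scope.
Variable p : nat.
Hypotheses (p_pr : prime p) (p_odd : odd p).
Local Notation P := (fps 'F_p).
Local Notation X := (@fpsX 'F_p).
Local Notation N := (nottingham p).
Implicit Types (f g h e : N).

Lemma nott_with_lead k (u v : 'F_p) : (0 < k)%N ->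
  exists e : N, [/\ depth_ge k e, e X k.+1 = u & e X k.+2 = v].
Proof.
move=> k0; pose s : P := X + X ^+ k.+1 * (fps_const u + X * fps_const v).
have sE i : s i = X i +
    (if (i < k.+1)%N then 0 else (fps_const u + X * fps_const v) (i - k.+1)%N).
  by rewrite /s [LHS]fps_coefD fps_coefXnM.
have [||e eX] := @nott_of_series p s.
- by rewrite sE /= addr0.
- by rewrite sE /= ltnS k0 addr0.
exists e; rewrite /depth_ge eX; split.
- by apply/eqmodXP; exists (fps_const u + X * fps_const v).
- rewrite sE ltnn subnn fps_coefD fps_coefXM0 addr0.
  by case: k k0 {s sE eX} => //= k _; rewrite add0r.
- rewrite sE ltnNge leqnSn subSnn fps_coefD fps_coefXMS.
  by rewrite /= !add0r.
Qed.

Lemma Fp_nat_repr (c : 'F_p) : exists n : nat, n%:R = c.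
Proof. by exists (nat_of_ord c); rewrite natr_Zp. Qed.

Lemma commg_powl f h n : [~ f, (f ^+ n * h)%g]%g = [~ f, h]%g.
Proof.
have fn : (f ^ (f ^+ n) = f)%g by apply/conjg_fixP; rewrite commgXg.
by rewrite !commgEl conjgM fn.
Qed.

(** Up to powers of [x], a commutator of [x] and [h] of depth at least [p + 2]
    needs [h] of depth at least [p + 1], and then its term of depth [p + 2] vanishes:
    the bracket carries the factor [(p + 1) - 1]. *)
Lemma not_comm_depth1 x e h : fslope x != 0 ->
  depth_ge p.+2 e -> e X p.+3 != 0 -> ~ eqmodX p.+4 ([~ x, h]%g X) (e X).
Proof.
move=> a0 ep e0 he; have [n nE] := Fp_nat_repr (fslope h / fslope x).
have [h' hE h'2] : exists2 h', h = (x ^+ n * h')%g & depth_ge 2 h'.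
  exists ((x ^+ n)^-1 * h)%g; first by rewrite mulKVg.
  apply: fslope0_depth2; rewrite fslopeM fslopeV fslopeX nE divfK //.
  by rewrite addNr.
rewrite hE commg_powl in he; have p2 := prime_gt1 p_pr.
have [h'p|/exact_depth[d [/andP[d0 dp] h'd h'0]]] := pselect (depth_ge p.+1 h').
  have [_] := depth_ge_comm (ltn0Sn 0) (ltn0Sn p) (depth_ge1 x) h'p.
  rewrite he // -natr1 pchar_Fp_0 // add0r subrr !mul0r.
  by apply/eqP.
have d1 : (1 < d)%N.
  rewrite ltn_neqAle d0 andbT; apply: contraNneq h'0 => <-.
  by apply/eqP; apply: h'2.
have [_] := depth_ge_comm (ltn0Sn 0) d0 (depth_ge1 x) h'd.
rewrite he ?ep; try lia.
rewrite /= => /esym/eqP; rewrite !mulf_eq0 (negPf h'0) (negPf a0) !orbF subr_eq0.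
move=> /eqP/(Fp_nat_inj p_pr); have [dp'|pd] := ltnP d p.
  by rewrite !modn_small //; lia.
have -> : d = p by lia.
by rewrite modnn modn_small.
Qed.

(** Up to powers of [y], a commutator of [y] and [h] of depth at least 4 needs [h]
    of depth at least 3, which puts it in depth 5. *)
Lemma not_comm_depth2 y e h : fslope y = 0 -> fcurv y != 0 ->
  depth_ge 4 e -> e X 5%N != 0 -> ~ eqmodX 6 ([~ y, h]%g X) (e X).
Proof.
move=> a0 c0 e4 e0 he; have y2 := fslope0_depth2 a0.
have [b0|b0] := eqVneq (fslope h) 0; last first.
  have [_] := depth_ge_comm (ltn0Sn 1) (ltn0Sn 0) y2 (depth_ge1 h).
  rewrite he // e4 // -fcurv_depth2 // => /esym/eqP.
  have -> : 1%:R - 2%:R = -1 :> 'F_p by ring.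
  by rewrite !mulf_eq0 oppr_eq0 oner_eq0 (negPf c0) /=; apply/negP.
have [n nE] := Fp_nat_repr (fcurv h / fcurv y).
have [h' hE h'3] : exists2 h', h = (y ^+ n * h')%g & depth_ge 3 h'.
  exists ((y ^+ n)^-1 * h)%g; first by rewrite mulKVg.
  apply: fcurv0_depth3; first by rewrite fslopeM fslopeV fslopeX a0 b0 mulr0 oppr0 addr0.
  by rewrite fcurvM fcurvV fcurvX nE divfK // addNr.
rewrite hE commg_powl in he.
have [h5 _] := depth_ge_comm (ltn0Sn 1) (ltn0Sn 2) y2 h'3.
by move: e0; rewrite -he // h5.
Qed.

End NonConjugate.

(** * Generation *)

Section Generation.
Local Open Scope group_scope.
Variable p : nat.
Hypotheses (p_pr : prime p) (p_odd : odd p).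
Local Notation P := (fps 'F_p).
Local Notation X := (@fpsX 'F_p).
Local Notation N := (nottingham p).
Implicit Types (f g h : N).

Variables (gT : finGroupType) (phi : UMagmaMorphism.type N gT).
Hypothesis phi_surj : forall y, exists x, phi x = y.
Variable m : nat.
Hypothesis phi_ker : forall f, depth_ge m f -> phi f = 1.

(** A subgroup with elements of every depth is everything, and commutators with
    elements of depth 1 and 2 produce all depths: depth [k] is reached from
    [1 + (k - 1)], or from [2 + (k - 2)] if the former bracket vanishes. *)
Lemma generated_of_fdet x y : fdet x y != 0%R ->
  <<[set phi x; phi y]>> = [set: gT].
Proof.
move=> det0; set H := <<_>>.
have Hx : phi x \in H by rewrite mem_gen // !inE eqxx.
have Hy : phi y \in H by rewrite mem_gen // !inE eqxx orbT.
have E1 : exists f, [/\ depth_ge 1 f, f X 2%N != 0%R & phi f \in H].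
  have [ax|ax] := eqVneq (fslope x) 0%R; last by exists x; split=> //; apply: depth_ge1.
  exists y; split=> //; first exact: depth_ge1.
  by apply: contraNneq det0 => ay; rewrite /fdet ax [fslope y]ay !mul0r subrr.
have E2 : exists f, [/\ depth_ge 2 f, f X 3%N != 0%R & phi f \in H].
  have [i iE] := Fp_nat_repr (fslope y); have [j jE] := Fp_nat_repr (- fslope x)%R.
  have a0 : fslope (x ^+ i * y ^+ j) = 0%R.
    by rewrite fslopeM !fslopeX iE jE; ring.
  exists (x ^+ i * y ^+ j); split; first exact: fslope0_depth2.
    rewrite -fcurv_depth2 // fcurvM !fcurvX iE jE; apply: contraNneq det0 => e.
    by rewrite /fdet -oppr_eq0 -[X in _ == X]e; apply/eqP; ring.
  by rewrite gmulfM !gmulfXn groupM ?groupX.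
have E k : (0 < k)%N -> exists f, [/\ depth_ge k f, f X k.+1 != 0%R & phi f \in H].
  elim/ltn_ind: k => k IHk k0; case: k k0 IHk => [|[|[|k]]] // _ IHk.
  have comm i j f g : (0 < i)%N -> (0 < j)%N -> (j%:R != i%:R :> 'F_p)%R ->
      [/\ depth_ge i f, f X i.+1 != 0%R & phi f \in H] ->
      [/\ depth_ge j g, g X j.+1 != 0%R & phi g \in H] ->
    exists h, [/\ depth_ge (i + j) h, h X (i + j).+1 != 0%R & phi h \in H].
    move=> i0 j0 ij [fi f0 Hf] [gj g0 Hg].
    have [hij hE] := depth_ge_comm i0 j0 fi gj; exists [~ f, g]; split=> //.
      by rewrite hE !mulf_neq0 // subr_eq0.
    by rewrite gmulfR groupR.
  (* When [k.+2] is 1 modulo [p], the bracket of depths 1 and [k.+2] vanishes,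
     but that of depths 2 and [k.+1] does not, as 0 is not 2. *)
  have [k1|k1] := eqVneq ((k.+2)%:R : 'F_p)%R 1%R.
    have k10 : (0 < k.+1)%N by [].
    have [f fP] := E2; have [g gP] := IHk k.+1 (leqnSn k.+2) k10.
    apply: (comm 2%N k.+1 f g) => //.
    have -> : (k.+1%:R = 0 :> 'F_p)%R.
      by apply: (addIr 1%R); rewrite natr1 k1 add0r.
    by rewrite eq_sym (Fp_two_neq0 p_pr).
  have [f fP] := E1; have [g gP] := IHk k.+2 (ltnSn k.+2) isT.
  exact: (comm 1%N k.+2 f g).
have main j k f : (m <= k + j)%N -> (0 < k)%N -> depth_ge k f -> phi f \in H.
  elim: j k f => [|j IHj] k f mk k0 fk.
    by rewrite phi_ker ?group1 //; apply: depth_ge_leq fk; rewrite addn0 in mk.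
  have [g [gk g0 Hg]] := E k k0.
  have [n nE] := Fp_nat_repr (f X k.+1 / g X k.+1)%R.
  rewrite -(mulKVg (g ^+ n) f) gmulfM groupM ?gmulfXn ?groupX //.
  apply: (IHj k.+1); rewrite ?addSnnS //; apply: depth_geS => //.
    by apply: depth_geM => //; apply/depth_geV/depth_geX.
  have gn := depth_geX n gk; rewrite (nott_mul_coef (depth_geV gn) fk); try lia.
  rewrite (nott_inv_coef gn) ?(nott_pow_coef n gk) ?nE ?divfK ?addNr //; lia.
apply/eqP; rewrite eqEsubset subsetT; apply/subsetP => w _.
have [f <-] := phi_surj w; apply: (main m 1%N); rewrite ?leq_addl //.
exact: depth_ge1.
Qed.

End Generation.

(** * Quotients of order p ^ n *)

Section DeepQuotients.
Local Open Scope group_scope.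
Variable p : nat.
Hypotheses (p_pr : prime p) (p_odd : odd p).
Local Notation P := (fps 'F_p).
Local Notation X := (@fpsX 'F_p).
Local Notation N := (nottingham p).
Implicit Types (f g h z : N).

(** Truncation at depth [n + 1] is good enough unless [n] is 1 modulo [p], when
    [n] may be the depth of a power of [z], whose second term would be lost. In
    that case one truncates at depth [n + 2] and factors out the central subgroup
    generated by [e = X + X ^ (n+1) + X ^ (n+2)]: the powers of [z] of depth [n]
    have equal leading coefficients, so they are powers of [e] modulo depth
    [n + 2], and disappear. *)
Lemma quotient_seeing_powers n : (1 < n)%N ->
  exists (gT : finGroupType) (phi : UMagmaMorphism.type N gT),
  [/\ forall y, exists x, phi x = y, #|gT| = (p ^ n)%N,
      (forall f, phi f = 1 -> depth_ge (n + (n %% p != 1)%N) f),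
      (forall f, depth_ge n.+2 f -> phi f = 1)
    & forall z, fslope z = 1%R -> fcurv z = 1%R -> powers_seen phi z].
Proof.
move=> n1; have p1 := prime_gt1 p_pr.
have seen_mod z r d : fslope z = 1%R -> (1 < d)%N -> depth_ge d (z ^+ r) ->
    (z ^+ r) X d.+1 != 0%R -> d %% p = 1%N /\
    (fcurv z = 1 -> (z ^+ r)%g X d.+2 = (z ^+ r)%g X d.+1)%R.
  move=> z1 d1 zd z0; have zz : commute z (z ^+ r) by apply: commuteX.
  have [|d1p dv] := commute_slope p_pr p_odd d1 zz zd z0; first by rewrite z1 oner_eq0.
  split; first by rewrite (@Fp_nat_inj _ p_pr d 1 d1p) modn_small.
  by move=> c1; rewrite z1 c1 !mul1r in dv.
have [np|np] := eqVneq (n %% p) 1%N; last first.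
  have [gT [phi [surj cardT ker]]] := truncation_quotient n p_pr.
  exists gT, phi; split=> //.
  - by move=> f /ker; rewrite addn1.
  - by move=> f fn; apply/ker; apply: depth_ge_leq fn.
  move=> z z1 c1 r zr.
  have [|d [/andP[d0 dn] zd z0]] := @exact_depth _ n.+1 (z ^+ r).
    by move/ker => zr1; rewrite zr1 eqxx in zr.
  exists d; split=> // k /ker; apply: depth_ge_leq.
  move: dn; rewrite ltnS leq_eqVlt => /predU1P[dE|//].
  rewrite dE in zd z0; have [nE _] := seen_mod z r n z1 n1 zd z0.
  by rewrite nE in np.
have n0 := ltnW n1.
have [gT [phi [surj cardT ker]]] := truncation_quotient n.+1 p_pr.
have [e [en e1 e2]] := @nott_with_lead p n 1%R 1%R n0.
have ekX k : (e ^+ k) X n.+1 = k%:R%R /\ (e ^+ k) X n.+2 = k%:R%R.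
  by split; rewrite (nott_pow_coef k en) ?e1 ?e2 ?mulr1 //; lia.
have deep f : depth_ge n f -> f X n.+1 = 0%R -> f X n.+2 = 0%R -> phi f = 1.
  by move=> fn f1 f2; apply/ker; do 2!apply: depth_geS => //.
have nR : (n%:R = 1 :> 'F_p)%R by rewrite -(Fp_nat_mod p_pr) np.
have cent f : commute (phi f) (phi e).
  apply/commgP; rewrite -gmulfR; apply/eqP/ker.
  have [fe fe0] := depth_ge_comm (ltn0Sn 0) n0 (depth_ge1 f) en.
  by apply: depth_geS => //; rewrite fe0 nR subrr !mul0r.
have ep : #[phi e] = p.
  have : #[phi e] %| p.
    rewrite order_dvdn -gmulfXn; apply/eqP/deep; first exact: depth_geX.
      by rewrite (ekX p).1 pchar_Fp_0.
    by rewrite (ekX p).2 pchar_Fp_0.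
  have /primeP[_ pP] := p_pr; move/pP => /orP[|/eqP //]; rewrite order_eq1.
  move=> /eqP/ker e0; move: e1; rewrite e0 //= eqSS (gtn_eqF n0) => /esym/eqP.
  by rewrite oner_eq0.
have [hT [psi [psi_surj cardh psi_ker]]] := cyclic_quotient surj cent.
have psi_depth f : psi f = 1 -> depth_ge n f.
  case/psi_ker => k /(phi_eq_mod (fun h => (ker h).1)) fk.
  exact: eqmodX_trans (eqmodX_leq (leq_addl 2 n.+1) fk) (depth_geX k en).
have p2 : 2 < p by rewrite ltn_neqAle p1 andbT; apply: contraTneq p_odd => <-.
have succ_mod d : d %% p = 1%N -> d.+1 %% p = 2.
  by move=> dp; rewrite -addn1 -modnDml dp modn_small.
have pn : p < n.
  rewrite ltnNge leq_eqVlt; apply/negP => /predU1P[nE|np'].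
    by rewrite nE modnn in np.
  by rewrite modn_small // in np; rewrite np in n1.
exists hT, psi; split=> //.
- apply/eqP; rewrite -(eqn_pmul2r (prime_gt0 p_pr)) -[X in (_ * X)%N == _]ep cardh.
  by rewrite cardT expnSr.
- by move=> f; rewrite addn0; apply: psi_depth.
- by move=> f /ker f1; apply/psi_ker; exists 0; rewrite f1 gmulf1.
move=> z z1 c1 r zr.
have [|d [/andP[d0 dn] zd z0]] := @exact_depth _ n.+2 (z ^+ r).
  move/ker => zr1; have /psi_ker zr0 : exists k, phi (z ^+ r) = phi (e ^+ k).
    by exists 0; rewrite zr1 gmulf1.
  by rewrite zr0 eqxx in zr.
exists d; split=> // k /psi_depth; apply: depth_ge_leq.
have [->|d1] := eqVneq d 1%N; first by lia.
have {}d1 : 1 < d by lia.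
have [dp dv] := seen_mod z r d z1 d1 zd z0.
have dS := succ_mod d dp; have nS := succ_mod n np.
have [dE|dnE] := eqVneq d n; last first.
  have [dE|dn1] := eqVneq d n.+1; first by rewrite dE nS in dp.
  have [dE|dn2] := eqVneq d.+1 n; first by rewrite dE np in dS.
  by lia.
move: dv zd z0; rewrite dE => /(_ c1) dv zd z0.
have [i iE] := Fp_nat_repr ((z ^+ r) X n.+1).
case/negP: zr; apply/eqP/psi_ker; exists i; apply/divg1_eq.
rewrite -gmulfV -gmulfM; apply: deep.
- by apply: depth_geM => //; apply/depth_geV/depth_geX.
- have ei := depth_geX i en; rewrite (nott_mul_coef zd (depth_geV ei)); try lia.
  by rewrite (nott_inv_coef ei) ?(ekX i).1 ?iE ?subrr //; lia.
- have ei := depth_geX i en; rewrite (nott_mul_coef zd (depth_geV ei)); try lia.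
  by rewrite (nott_inv_coef ei) ?(ekX i).2 ?iE ?dv ?subrr //; lia.
Qed.

End DeepQuotients.

(** * Beauville structures *)

Section BeauvilleQuotients.
Local Open Scope group_scope.
Variable p : nat.
Hypotheses (p_pr : prime p) (p_odd : odd p).
Local Notation P := (fps 'F_p).
Local Notation X := (@fpsX 'F_p).
Local Notation N := (nottingham p).
Implicit Types (f g h e x y : N).

Variables (gT : finGroupType) (phi : UMagmaMorphism.type N gT).

Lemma nonconj_of_comm f e : (forall h, phi [~ f, h] <> phi e) ->
  forall h, phi f <> phi ((f * e) ^ h).
Proof.
move=> fe h; rewrite gmulfJ => fh; apply: (fe h^-1).
by rewrite commgEl gmulfM gmulfJ !gmulfV {2}fh conjgK gmulfM mulKg.
Qed.

Variables (n m : nat) (x y : N).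
Hypothesis phi_surj : forall v, exists f, phi f = v.
Hypothesis ker3 : forall f, phi f = 1 -> depth_ge 3 f.
Hypothesis kerm : forall f, depth_ge m f -> phi f = 1.
Hypothesis seen : forall z, fslope z = 1%R -> fcurv z = 1%R -> powers_seen phi z.
Hypotheses (xp : x ^+ p = 1) (xa : fslope x = 1%R) (xc : fcurv x = 0%R).
Hypotheses (yp : y ^+ p = 1) (ya : fslope y = 0%R) (yc : fcurv y = 1%R).

(** The condition on [fcurv] and [fslope] keeps the second triple off the line
    of [x * y]. *)
Lemma beauville_of_disjoint g1 g2 : fdet g1 g2 != 0%R ->
    {in [:: phi g1; phi g2; phi (g1 * g2)], forall v,
      conj_disjoint (phi x) v /\ conj_disjoint (phi y) v} ->
    {in [:: g1; g2; g1 * g2], forall g, fcurv g != fslope g} ->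
  beauville_group [set: gT]%G.
Proof.
move=> det0 disj zdet; apply: (@beauville_setT _ (phi x) (phi y) (phi g1) (phi g2)).
- apply: (generated_of_fdet p_pr p_odd phi_surj kerm).
  by rewrite /fdet xa xc ya yc mulr1 mul0r subr0 oner_eq0.
- exact: (generated_of_fdet p_pr p_odd phi_surj kerm).
have zdisj g : fcurv g != fslope g -> conj_disjoint (phi (x * y)) (phi g).
  have za : fslope (x * y) = 1%R by rewrite fslopeM xa ya addr0.
  have zc : fcurv (x * y) = 1%R by rewrite fcurvM xc yc add0r.
  move=> g0; apply: (seen_disjoint p_pr p_odd phi_surj); first exact: seen.
  by rewrite /fdet za zc mul1r mulr1 subr_eq0.
rewrite -!gmulfM => u v; rewrite !inE => /or3P[]/eqP-> vT.
- by case: (disj v _); rewrite ?inE.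
- by case: (disj v _); rewrite ?inE.
case/or3P: vT => /eqP->; apply/zdisj/zdet; rewrite !inE eqxx ?orbT //.
Qed.

Let xdisj g : fcurv g != 0%R -> conj_disjoint (phi x) (phi g).
Proof.
move=> g0; apply: (torsion_disjoint p_pr phi_surj ker3 xp).
by rewrite /fdet xa xc mul1r mulr0 subr0.
Qed.

Let ydisj g : fslope g != 0%R -> conj_disjoint (phi y) (phi g).
Proof.
move=> g0; apply: (torsion_disjoint p_pr phi_surj ker3 yp).
by rewrite /fdet ya yc mul0r mulr1 sub0r oppr_eq0.
Qed.

(** The lines of [x], [y] and [x * y] have ratios [fcurv / fslope] equal to 0,
    infinity and 1. The ratios 2, -1 and 1/2 of [(1, 2)], [(1, -1)] and their sum
    [(2, 1)] differ from those, and [(1, 2)], [(1, -1)] are independent because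
    [p] is not 3. *)
Lemma beauville_large : p != 3 -> beauville_group [set: gT]%G.
Proof.
move=> p3; have two0 := Fp_two_neq0 p_pr p_odd.
have [g1 [_ a1 c1]] := @nott_with_lead p 1 1%R 3%:R%R isT.
have [g2 [_ a2 c2]] := @nott_with_lead p 1 1%R 0%R isT.
have {}c1 : fcurv g1 = 2%:R%R by rewrite /fcurv c1 a1; ring.
have {}c2 : fcurv g2 = (-1)%R by rewrite /fcurv c2 a2; ring.
have {}a1 : fslope g1 = 1%R by []. have {}a2 : fslope g2 = 1%R by [].
have m10 : (-1 != 0 :> 'F_p)%R by rewrite oppr_eq0 oner_eq0.
apply: (@beauville_of_disjoint g1 g2).
- rewrite /fdet a1 c1 a2 c2.
  have -> : (1 * -1 - 1 * 2%:R = - 3%:R :> 'F_p)%R by ring.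
  by rewrite oppr_eq0 (Fp_nat_eq0 p_pr) dvdn_prime2.
- move=> v; rewrite !inE => /or3P[]/eqP->; split; [apply: xdisj|apply: ydisj|
    apply: xdisj|apply: ydisj|apply: xdisj|apply: ydisj];
    rewrite ?fslopeM ?fcurvM ?a1 ?a2 ?c1 ?c2 ?oner_eq0 //.
  by rewrite mulr2n addrK oner_eq0.
move=> g; rewrite !inE => /or3P[]/eqP->;
  rewrite ?fslopeM ?fcurvM ?a1 ?a2 ?c1 ?c2 -subr_eq0.
- by rewrite mulr2n addrK oner_eq0.
- have -> : (-1 - 1 = - 2%:R :> 'F_p)%R by ring.
  by rewrite oppr_eq0.
- have -> : (2%:R - 1 - (1 + 1) = - 1 :> 'F_p)%R by ring.
  by [].
Qed.

(** For [p = 3] there are only four lines, so the second triple reuses those of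
    [x] and [y] with elements not conjugate to [x] and [y]. Inverting the second
    one moves the product to the line of ratio -1, away from that of [x * y]. *)
Lemma beauville_deep : #|gT| = (p ^ n)%N ->
  (forall f, phi f = 1 -> depth_ge p.+3 f) -> beauville_group [set: gT]%G.
Proof.
move=> cardT kerp; have p2 := odd_prime_gt2 p_odd p_pr.
have two0 := Fp_two_neq0 p_pr p_odd.
have m10 : (-1 != 0 :> 'F_p)%R by rewrite oppr_eq0 oner_eq0.
have [e [ed e1 _]] := @nott_with_lead p p.+2 1%R 0%R isT.
have [e' [e'd e'1 _]] := @nott_with_lead p 4 1%R 0%R isT.
have deep f : depth_ge 3 f -> fslope f = 0%R /\ fcurv f = 0%R.
  by move=> f3; rewrite /fcurv /fslope !f3 // expr0n subrr.
have [ea ec] : fslope e = 0%R /\ fcurv e = 0%R.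
  by apply/deep/(depth_ge_leq _ ed); lia.
have [e'a e'c] : fslope e' = 0%R /\ fcurv e' = 0%R.
  exact/deep/(depth_ge_leq _ e'd).
have xe : conj_disjoint (phi x) (phi (x * e)).
  apply: (nonconj_disjoint p_pr phi_surj cardT ker3 xp).
  - by rewrite xa oner_eq0.
  - by rewrite fslopeM ea addr0.
  - by rewrite fcurvM ec addr0.
  apply: nonconj_of_comm => h /(phi_eq_mod kerp).
  by apply: not_comm_depth1; rewrite ?xa ?e1 ?oner_eq0.
have ye : conj_disjoint (phi y) (phi (y * e')^-1).
  rewrite gmulfV; apply: conj_disjointV.
  apply: (nonconj_disjoint p_pr phi_surj cardT ker3 yp).
  - by rewrite yc oner_eq0 orbT.
  - by rewrite fslopeM e'a addr0.
  - by rewrite fcurvM e'c addr0.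
  apply: nonconj_of_comm => h /(phi_eq_mod kerp) he.
  apply: (@not_comm_depth2 _ y e' h); rewrite ?yc ?e'1 ?oner_eq0 //.
  by apply: eqmodX_leq he; lia.
have a1 : fslope (x * e) = 1%R by rewrite fslopeM xa ea addr0.
have c1 : fcurv (x * e) = 0%R by rewrite fcurvM xc ec addr0.
have a2 : fslope (y * e')^-1 = 0%R by rewrite fslopeV fslopeM ya e'a addr0 oppr0.
have c2 : fcurv (y * e')^-1 = (-1)%R by rewrite fcurvV fcurvM yc e'c addr0.
apply: (@beauville_of_disjoint (x * e) (y * e')^-1).
- by rewrite /fdet a1 c1 a2 c2 mul1r mul0r subr0.
- move=> v; rewrite !inE => /or3P[]/eqP->; split=> //; [apply: ydisj|
    apply: xdisj|apply: xdisj|apply: ydisj];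
    by rewrite ?(fslopeM (x * e)) ?(fcurvM (x * e)) ?a1 ?a2 ?c1 ?c2 ?addr0 ?add0r
      ?oner_eq0.
move=> g; rewrite !inE => /or3P[]/eqP->;
  rewrite ?(fslopeM (x * e)) ?(fcurvM (x * e)) ?a1 ?a2 ?c1 ?c2 //.
rewrite sub0r addr0 -subr_eq0.
have -> : (-1 - 1 = - 2%:R :> 'F_p)%R by ring.
by rewrite oppr_eq0.
Qed.

End BeauvilleQuotients.

Theorem theoremB (p : nat) (p_pr : prime p) (p_odd : odd p) (n : nat)
    (hn : (if p == 3 then 5 else 2) <= n) :
  exists gT : finGroupType,
    [/\ is_finite_quotient gT (nottingham p), #|gT| = p ^ n
      & beauville_group [set: gT]%G].
Proof.
have n1 : 1 < n by case: ifP hn => _ // hn; apply: leq_trans hn.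
have p2 := odd_prime_gt2 p_odd p_pr.
have [gT [phi [surj cardT ker kern seen]]] := quotient_seeing_powers p_pr p_odd n1.
have [x [xp xa xc]] := torsion_depth1 p_pr.
have [y [yp ya yc]] := torsion_depth2 p_pr p_odd.
have ker3 f : phi f = 1%g -> depth_ge 3 f.
  move/ker; apply: depth_ge_leq; case: eqVneq => /= np; last by lia.
  rewrite addn0 ltn_neqAle n1 andbT; apply: contra_eqN np => /eqP <-.
  by rewrite modn_small.
exists gT; split=> //; first by exists phi.
have [p3|p3] := eqVneq p 3; last first.
  exact: (beauville_large p_pr p_odd surj ker3 kern seen xp xa xc yp ya yc).
apply: (beauville_deep p_pr p_odd surj ker3 kern seen xp xa xc yp ya yc cardT).
move=> f /ker; apply: depth_ge_leq; rewrite p3 in hn *.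
case: eqVneq => /= np; rewrite /= in hn *; last by lia.
have n5 : n != 5 by apply: contra_eqN np => /eqP ->.
have n6 : n != 6 by apply: contra_eqN np => /eqP ->.
by lia.
Qed.
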